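(* Let $M$ be a finite monoid and let $\mathbf A$ be the pseudovariety of finite aperiodic monoids. Then the maximal $\mathbf A$-triples of $M$ are the maximal triples $(A,B,C)\in\mathsf{PL}_{\mathbf A}(M)^3$ such that one of the following occurs: (1) $BC=B$; (2) there exists $T\in\mathsf{PL}_{\mathbf A}(M)$ such that $ABT=A$ and $C=TB$; (3) there exist $S,T\in\mathsf{PL}_{\mathbf A}(M)$ and $i\ge 1$ such that $A=ATS$, $B=(TS)^iT$ and $C=ST$. (Maximality is with respect to componentwise inclusion.) In particular, $\mathbf A$-triples are decidable, i.e. there is an algorithm that, given a finite monoid $M$ and a triple of subsets of $M$, decides whether it is an $\mathbf A$-triple.
   Context: A relational morphism $\varphi:M\to N$ of monoids assigns to each $m\in M$ a non-empty subset $m\varphi\subseteq N$ such that $1\in 1\varphi$ and $(m\varphi)(m'\varphi)\subseteq (mm')\varphi$. For $n\in N$, $n\varphi^{-1}=\{m\in M: n\in m\varphi\}$. Let $\mathbf V$ be a pseudovariety of monoids and $M$ a finite monoid. A subset $Z\subseteq M$ is $\mathbf V$-pointlike if for every relational morphism $\varphi:M\to N$ with $N\in\mathbf V$ there exists $n\in N$ with $Z\subseteq n\varphi^{-1}$. The set $\mathsf{PL}_{\mathbf V}(M)$ of $\mathbf V$-pointlike subsets is a submonoid of the power set monoid $P(M)$ (with product $AB=\{ab:a\in A,b\in B\}$ and identity $\{1\}$). A triple $(A,B,C)$ of subsets of $M$ is a $\mathbf V$-triple if, for all relational morphisms $\varphi:M\to N$ with $N\in\mathbf V$, there exist $a,b,c\in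 N$ such that $A\subseteq a\varphi^{-1}$, $B\subseteq b\varphi^{-1}$, $C\subseteq c\varphi^{-1}$ and $abc=ab$. *)

(* Defs.v *)
From HB Require Import structures.
From mathcomp Require Import all_boot.

Set Implicit Arguments.
Unset Strict Implicit.
Unset Printing Implicit Defensive.

Local Open Scope group_scope.

#[short(type="finMonoidType")]
HB.structure Definition FinMonoid := {M of monoid.Monoid M & Finite M}.

(* P(M). A separate name for {set M}, because {set gT} already carries a
   monoid structure when gT is a finStarMonoidType. *)
Definition powset (M : finMonoidType) : Type := {set M}.

Section PowerMonoid.
Variable M : finMonoidType.
Implicit Types A B C : powset M.

HB.instance Definition _ := Finite.copy (powset M) {set M}.

Definition powset_one : powset M := [set 1].
Definition powset_mul A B : powset M := [set x * y | x in A, y in B].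

Lemma powset_mulA : associative powset_mul.
Proof.
move=> A B C; apply/setP=> z; apply/imset2P/imset2P => [[x w Ax] | [w z' + Cz']].
  case/imset2P=> y z' By Cz' -> ->; exists (x * y) z' => //.
    by apply/imset2P; exists x y.
  by rewrite mulgA.
case/imset2P=> x y Ax By -> ->; exists x (y * z') => //.
  by apply/imset2P; exists y z'.
by rewrite mulgA.
Qed.

Lemma powset_mul1s : left_id powset_one powset_mul.
Proof.
move=> A; apply/setP=> z; apply/imset2P/idP => [[x y /set1P-> Ay ->] | Az].
  by rewrite mul1g.
by exists 1 z; rewrite ?mul1g ?set11.
Qed.

Lemma powset_muls1 : right_id powset_one powset_mul.
Proof.
move=> A; apply/setP=> z; apply/imset2P/idP => [[x y Ax /set1P-> ->] | Az].
  by rewrite mulg1.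
by exists z 1; rewrite ?mulg1 ?set11.
Qed.

HB.instance Definition _ := isMonoid.Build (powset M)
  powset_mulA powset_mul1s powset_muls1.

End PowerMonoid.

Definition relational_morphism (M N : finMonoidType) (phi : M -> powset N) :=
  [/\ forall m : M, phi m != set0,
      1 \in phi 1
    & forall m m' : M, phi m * phi m' \subset phi (m * m')].

Definition rel_preim (M N : finMonoidType) (phi : M -> powset N) (n : N) :
  powset M := [set m : M | n \in phi m].

(* A class of finite monoids is a predicate V on finMonoidType. *)
Definition aperiodic (N : finMonoidType) : Prop :=
  exists n : nat, forall x : N, x ^+ n.+1 = x ^+ n.

Definition pointlike (V : finMonoidType -> Prop) (M : finMonoidType)
    (Z : powset M) : Prop :=
  forall (N : finMonoidType) (phi : M -> powset N),
    V N -> relational_morphism phi -> exists n : N, Z \subset rel_preim phi n.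

Definition V_triple (V : finMonoidType -> Prop) (M : finMonoidType)
    (A B C : powset M) : Prop :=
  forall (N : finMonoidType) (phi : M -> powset N),
    V N -> relational_morphism phi ->
    exists a b c : N,
      [/\ A \subset rel_preim phi a, B \subset rel_preim phi b,
          C \subset rel_preim phi c & a * b * c = a * b].

Definition maximal_triple (M : finMonoidType)
    (R : powset M -> powset M -> powset M -> Prop) (A B C : powset M) : Prop :=
  R A B C /\
  forall A' B' C' : powset M, R A' B' C' ->
    A \subset A' -> B \subset B' -> C \subset C' ->
    [/\ A' = A, B' = B & C' = C].

(* The total recursive functions: the least class of functions containing the
   initial functions and closed under composition, primitive recursion and
   minimization of regular functions. *)
Inductive recursive : forall k : nat, (k.-tuple nat -> nat) -> Prop :=
| rec_zero k : recursive (fun _ : k.-tuple nat => 0%N)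
| rec_succ : recursive (fun v : 1.-tuple nat => (thead v).+1)
| rec_proj k (i : 'I_k) : recursive (fun v : k.-tuple nat => tnth v i)
| rec_comp k m (f : m.-tuple nat -> nat) (g : 'I_m -> k.-tuple nat -> nat) :
    recursive f -> (forall i, recursive (g i)) ->
    recursive (fun v : k.-tuple nat => f [tuple g i v | i < m])
| rec_prim k (f : k.-tuple nat -> nat) (g : k.+2.-tuple nat -> nat) :
    recursive f -> recursive g ->
    recursive (fun v : k.+1.-tuple nat =>
      iteri (thead v) (fun i r => g [tuple of i :: r :: behead v])
        (f [tuple of behead v]))
| rec_mu k (f : k.+1.-tuple nat -> nat)
    (reg : forall v : k.-tuple nat, exists n, f [tuple of n :: v] == 0%N) :
    recursive f -> recursive (fun v : k.-tuple nat => ex_minn (reg v))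
| rec_ext k (f g : k.-tuple nat -> nat) :
    f =1 g -> recursive f -> recursive g.

(* A finite monoid whose elements are numbered 0, ..., n-1 by e is presented by
   n and its multiplication table read as a number in base n; a subset is
   presented by its characteristic word read as a number in base 2. *)
Definition table_code (M : finMonoidType) (n : nat) (e : M -> 'I_n) : nat :=
  (\sum_(x : M) \sum_(y : M) e (x * y)%g * n ^ (n * e x + e y))%N.

Definition subset_code (M : finMonoidType) (n : nat) (e : M -> 'I_n)
    (A : powset M) : nat := (\sum_(x in A) 2 ^ e x)%N.

Definition algorithmically_decidable
    (R : forall M : finMonoidType, powset M -> powset M -> powset M -> Prop) :
  Prop :=
  exists2 d : 5.-tuple nat -> nat, recursive d &
    forall (M : finMonoidType) (n : nat) (e : M -> 'I_n), bijective e ->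
    forall A B C : powset M,
      d [tuple n; table_code e; subset_code e A; subset_code e B;
               subset_code e C] = 1%N <-> R M A B C.

(* Main.v *)
(* Two words over a finite alphabet are k-equivalent, [u =[k]= v], when they have
   the same cuts up to (k-1)-equivalence; this is an Ehrenfeucht-Fraisse game.
   Each quotient of the free monoid by =[k]= is finite and aperiodic, and a
   factorization of one word transfers, one level down, to every equivalent word.

   If uvw and uv are k-equivalent, then transferring the cut (u, v) of uv to uvw,
   and then repeatedly the cut (v, w) of vw, yields for u, v, w at a lower level
   one of the three systems of equations of the theorem. These equations between
   words become equations between the sets of values of the words equivalent to
   u, v, w, ... at a level where these sets have stabilized.

   These sets are pointlike for large k by a Wilke-style induction proving
   Henckell's theorem: the pointlike sets are the subsets of the members of the
   least family of subsets that contains the singletons and is closed under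
   products and under b |-> the union of the b^j for large j. Hence they are
   decidable by a search over all families of subsets, and so are the triples. *)
From HB Require Import structures.
Require Import Defs.
From mathcomp Require Import all_boot boolp zify.

Set Implicit Arguments.
Unset Strict Implicit.
Unset Printing Implicit Defensive.

Local Open Scope group_scope.

(** * Equivalence of words *)

(** Levi's lemma for the free monoid: of two prefixes of one word, one is a prefix of the other. Two
    cuts of a word are compared through it below. *)
Lemma cat_eq_cat (T : Type) (s1 s2 t1 t2 : seq T) : s1 ++ s2 = t1 ++ t2 ->
  (exists r, t1 = s1 ++ r /\ s2 = r ++ t2) \/
  (exists r, s1 = t1 ++ r /\ t2 = r ++ s2).
Proof.
elim: s1 t1 => [|x s1 IH] [|y t1] /=; first by left; exists [::].
- by move->; left; exists (y :: t1).
- by move<-; right; exists (x :: s1).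
by case=> -> /IH[] [r [-> ->]]; [left | right]; exists r.
Qed.

(** Every word has its type of level [k] in this finite type, so finiteness of the quotients comes
    for free. *)
Fixpoint rank_type (X : finType) (k : nat) : finType :=
  if k is k'.+1 then {set (rank_type X k' * rank_type X k')%type} else option X.

(* At level 0 only the first letter is seen; this is what makes the empty word,
   and then every word of length at most k, alone in its class. *)
Fixpoint wtype (X : finType) (k : nat) (w : seq X) : rank_type X k :=
  match k with
  | 0 => ohead w
  | k'.+1 => [set (wtype k' (take i w), wtype k' (drop i w)) | i : 'I_(size w).+1]
  end.

Definition weq (X : finType) (k : nat) (u v : seq X) := wtype k u = wtype k v.

Notation "u =[ k ]= v" := (weq k u v)
  (at level 70, v at next level, format "u  =[ k ]=  v").

Section Words.
Variable X : finType.
Implicit Types (u v w x y z : seq X) (k : nat).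

Lemma weq_refl k u : u =[k]= u. Proof. by []. Qed.
Hint Resolve weq_refl : core.

Lemma weq_sym k u v : u =[k]= v -> v =[k]= u. Proof. by []. Qed.

Lemma weq_trans k u v w : u =[k]= v -> v =[k]= w -> u =[k]= w.
Proof. by rewrite /weq => ->. Qed.

Lemma weq_cut k u v z : u ++ v =[k.+1]= z ->
  exists x y, [/\ z = x ++ y, u =[k]= x & v =[k]= y].
Proof.
rewrite /weq /= => /setP /(_ (wtype k u, wtype k v)).
have lt_u : size u < (size (u ++ v)).+1 by rewrite ltnS size_cat leq_addr.
have -> : (wtype k u, wtype k v) \in
  [set (wtype k (take i (u ++ v)), wtype k (drop i (u ++ v)))
     | i : 'I_(size (u ++ v)).+1].
  apply/imsetP; exists (Ordinal lt_u) => //=.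
  by rewrite take_size_cat ?drop_size_cat.
move/esym/imsetP=> [i _ [eu ev]].
by exists (take i z), (drop i z); rewrite cat_take_drop.
Qed.

(** Converse of [weq_cut]: the two hypotheses are the answers to a cut made in either word. From
    here on a successor level is handled only through these two lemmas. *)
Lemma weqS k w z :
  (forall u v, w = u ++ v ->
     exists x y, [/\ z = x ++ y, u =[k]= x & v =[k]= y]) ->
  (forall u v, z = u ++ v ->
     exists x y, [/\ w = x ++ y, u =[k]= x & v =[k]= y]) ->
  w =[k.+1]= z.
Proof.
move=> wz zw; rewrite /weq /=; apply/eqP; rewrite eqEsubset.
have sub w' z' : (forall u v, w' = u ++ v ->
       exists x y, [/\ z' = x ++ y, u =[k]= x & v =[k]= y]) ->
    [set (wtype k (take i w'), wtype k (drop i w')) | i : 'I_(size w').+1]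
    \subset [set (wtype k (take i z'), wtype k (drop i z')) | i : 'I_(size z').+1].
  move=> wz'; apply/subsetP=> _ /imsetP[i _ ->].
  have [x [y [-> -> ->]]] := wz' _ _ (esym (cat_take_drop i w')).
  have lt_x : size x < (size (x ++ y)).+1 by rewrite ltnS size_cat leq_addr.
  apply/imsetP; exists (Ordinal lt_x) => //=.
  by rewrite take_size_cat ?drop_size_cat.
by rewrite !sub.
Qed.

Lemma weq_nil k u : u =[k]= [::] -> u = [::].
Proof.
elim: k u => [|k IH] u; first by case: u.
move/weq_sym/(@weq_cut _ [::] [::]) => [x [y [-> /weq_sym/IH-> /weq_sym/IH->]]].
by [].
Qed.

(** When [u] is cut before its first letter, [weq_nil] makes the left part of the answer empty, so
    the right part is all of [v]. *)
Lemma weqW k u v : u =[k.+1]= v -> u =[k]= v.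
Proof. by move/(@weq_cut _ [::] u) => [x [y [-> /weq_sym/weq_nil->]]]. Qed.

Lemma weq_leq j k u v : j <= k -> u =[k]= v -> u =[j]= v.
Proof.
by move/subnK <-; elim: (k - j) => //= n IH /weqW.
Qed.

Lemma weq_ohead k u v : u =[k]= v -> ohead u = ohead v.
Proof. by move/(weq_leq (leq0n k)). Qed.

(** A cut of a concatenation falls in one of the two factors and is answered there; the other factor
    is carried along, one level down. *)
Lemma weq_cat k u u' v v' : u =[k]= u' -> v =[k]= v' -> u ++ v =[k]= u' ++ v'.
Proof.
elim: k u u' v v' => [|k IH] u u' v v' eu ev.
  move: eu ev; rewrite /weq /=; case: u => [|a u] /=; case: u' => [|a' u'] //=.
have half p p' q q' : p =[k.+1]= p' -> q =[k.+1]= q' ->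
  forall x y, p ++ q = x ++ y ->
     exists x' y', [/\ p' ++ q' = x' ++ y', x =[k]= x' & y =[k]= y'].
  move=> ep eq x y /cat_eq_cat [] [r [Dx Dy]]; subst.
    have [x' [y' [-> ex ey]]] := weq_cut eq.
    exists (p' ++ x'), y'; rewrite catA; split=> //.
    by apply: IH => //; apply: weqW.
  have [x' [y' [-> ex ey]]] := weq_cut ep.
  exists x', (y' ++ q'); rewrite catA; split=> //.
  by apply: IH => //; apply: weqW.
by apply: weqS => x y /half; apply.
Qed.

Lemma weq_flatten_nseq k n u v : u =[k]= v ->
  flatten (nseq n u) =[k]= flatten (nseq n v).
Proof. by move=> e; elim: n => //= n IH; apply: weq_cat. Qed.

Lemma weq_short k u v : size u <= k -> u =[k]= v -> u = v.
Proof.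
elim: k u v => [|k IH] u v; first by case: u => // _ /weq_sym/weq_nil->.
case: u => [|a u] su; first by move/weq_sym/weq_nil.
move=> e; have /= := weq_cut (u := [:: a]) (v := u) e.
(* At level 1 a cut compares first letters only, so a one-letter word is treated apart: if [v] had a
   second letter, it could be cut into two non-empty words, which has no answer in one letter. *)
case: k IH su e => [|k] IH su e.
  case: u su e => // _ e _.
  case: v e (weq_ohead e) => [|b [|c v]] e //= [Dab]; first by rewrite Dab.
  have [x [y [Dxy ex ey]]] := weq_cut (u := [:: b]) (v := c :: v) (weq_sym e).
  by case: x y Dxy ex ey => [|? [|? ?]] [|? ?].
by move=> [x [y [-> /IH<- // /IH<-]]].
Qed.

End Words.

#[export] Hint Resolve weq_refl : core.

Section WordMorphisms.
Variables X Y : finType.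

Lemma weq_map (f : X -> Y) k (u v : seq X) :
  u =[k]= v -> map f u =[k]= map f v.
Proof.
elim: k u v => [|k IH] u v; first by case: u v => [|a u] [|b v] //= [->].
have half (w z : seq X) : w =[k.+1]= z -> forall x y, map f w = x ++ y ->
    exists x' y', [/\ map f z = x' ++ y', x =[k]= x' & y =[k]= y'].
  move=> e x y Dxy; have Ew := esym (cat_take_drop (size x) w).
  rewrite Ew in e; have [p [q [-> ep eq]]] := weq_cut e.
  exists (map f p), (map f q); rewrite map_cat; split=> //.
    by move: (IH _ _ ep); rewrite map_take Dxy take_size_cat.
  by move: (IH _ _ eq); rewrite map_drop Dxy drop_size_cat.
by move=> e; apply: weqS => x y /half; apply.
Qed.

End WordMorphisms.

(* [weq_wpow]: the exponent from which the powers of a word are k-equivalent. A cut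
   of a power of exponent 2m+1 leaves at least m factors on one of its sides. *)
Definition pow_index (k : nat) : nat := iter k (fun m => m.*2.+1) 1%N.

Section Powers.
Variable X : finType.
Implicit Types (u v w x y z : seq X) (k : nat).

Definition wpow w n := flatten (nseq n w).

Lemma wpowS w n : wpow w n.+1 = w ++ wpow w n. Proof. by []. Qed.

Lemma wpowD w m n : wpow w (m + n) = wpow w m ++ wpow w n.
Proof. by rewrite /wpow nseqD flatten_cat. Qed.

Lemma wpowSr w n : wpow w n.+1 = wpow w n ++ w.
Proof. by rewrite -addn1 wpowD /wpow /= cats0. Qed.

Lemma wpow_split w n x y : wpow w n.+1 = x ++ y ->
  exists i j u v, [/\ (i + j)%N = n, w = u ++ v, x = wpow w i ++ u
                   & y = v ++ wpow w j].
Proof.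
elim: n x y => [|n IH] x y.
  by rewrite wpowS cats0 => Dw; exists 0%N, 0%N, x, y; rewrite cats0.
rewrite wpowS => /cat_eq_cat[] [r [Dx Dy]].
  have [i [j [u [v [Dn Dw Dr ->]]]]] := IH _ _ Dy.
  by exists i.+1, j, u, v; rewrite addSn Dn Dx Dr wpowS catA.
by exists 0%N, n.+1, x, r.
Qed.

Lemma wpow_join u v i j : wpow (u ++ v) (i + j).+1 =
  (wpow (u ++ v) i ++ u) ++ (v ++ wpow (u ++ v) j).
Proof. by rewrite -addnS wpowD wpowS !catA. Qed.

Lemma weq_wpow k w n : pow_index k <= n -> wpow w n.+1 =[k]= wpow w n.
Proof.
move=> lekn; rewrite -(subnK lekn) -addnS; elim: k {n} (n - _)%N {lekn} w => [|k IH] d w.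
  rewrite !wpowD; apply: weq_cat => //.
  by rewrite /weq /= !wpowS; case: w.
rewrite !wpowD; apply: weq_cat => // {d}.
set m := pow_index k.
have absorb n : m <= n -> wpow w n.+1 =[k]= wpow w n.
  by move/subnK<-; rewrite -addnS; apply: IH.
have Dm : pow_index k.+1 = m.*2.+1 by [].
(* A cut of the longer power is answered by removing a factor [w] on a side that keeps at least [m]
   of them; a cut of the shorter one, treated second, by adding a factor on a side that has at least
   [m]. *)
rewrite Dm; apply: weqS => x y /wpow_split[i [j [u [v [Dij Dw -> ->]]]]].
  have [lemi|ltim] := leqP m.+1 i.
    case: i Dij lemi => // i; rewrite addSn => -[Dij] lemi.
    exists (wpow w i ++ u), (v ++ wpow w j); rewrite -Dij; split=> //.
      by rewrite Dw wpow_join.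
    by apply: weq_cat => //; apply: absorb.
  have ltmj : m < j.
    by move: Dij; rewrite -addnn; lia.
  case: j Dij ltmj => // j; rewrite addnS => -[Dij] lemj.
  exists (wpow w i ++ u), (v ++ wpow w j); rewrite -Dij; split=> //.
    by rewrite Dw wpow_join.
  by apply: weq_cat => //; apply: absorb.
have [lemi|ltim] := leqP m i.
  exists (wpow w i.+1 ++ u), (v ++ wpow w j); split=> //.
    by rewrite -Dij -addSn Dw wpow_join.
  by apply: weq_cat => //; apply/weq_sym/absorb.
have ltmj : m <= j by move: Dij; rewrite -addnn; lia.
exists (wpow w i ++ u), (v ++ wpow w j.+1); split=> //.
  by rewrite -Dij -addnS Dw wpow_join.
by apply: weq_cat => //; apply/weq_sym/absorb.
Qed.

Lemma weq_wpow_leq k w m n : pow_index k <= m -> pow_index k <= n ->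
  wpow w m =[k]= wpow w n.
Proof.
have H d : wpow w (pow_index k + d) =[k]= wpow w (pow_index k).
  elim: d => [|d IH]; first by rewrite addn0.
  by rewrite addnS; apply: weq_trans IH; apply: weq_wpow; rewrite leq_addr.
by move=> /subnKC<- /subnKC<-; apply: weq_trans (H _) (weq_sym (H _)).
Qed.

End Powers.

(** * Finite quotients of the free monoid *)

(** Only the types realized by a word are kept, so that each class has a representative and
    concatenation defines a product. *)
Definition wclass (X : finType) (k : nat) : Type :=
  {t : rank_type X k | `[< exists w, wtype k w = t >]}.

Section WordClasses.
Variables (X : finType) (k : nat).

HB.instance Definition _ := Finite.on (wclass X k).

Lemma wclass_of_subproof (w : seq X) : `[< exists u, wtype k u = wtype k w >].
Proof. by apply/asboolP; exists w. Qed.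

Definition wclass_of (w : seq X) : wclass X k :=
  exist (fun t => `[< exists u, wtype k u = t >]) _ (wclass_of_subproof w).

Definition wrepr (c : wclass X k) : seq X := projT1 (cid (asboolW (valP c))).

Lemma wclass_ofP u v : wclass_of u = wclass_of v <-> u =[k]= v.
Proof. by split=> [[]|e] //; apply: val_inj. Qed.

Lemma wreprK : cancel wrepr wclass_of.
Proof. by move=> c; apply: val_inj; rewrite /= /wrepr; case: cid. Qed.

Definition wclass_one : wclass X k := wclass_of [::].
Definition wclass_mul c d : wclass X k := wclass_of (wrepr c ++ wrepr d).

Lemma wclass_of_cat u v : wclass_of (u ++ v) = wclass_mul (wclass_of u) (wclass_of v).
Proof.
by apply/wclass_ofP; apply: weq_cat; apply/wclass_ofP; rewrite wreprK.
Qed.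

Lemma wclass_mulA : associative wclass_mul.
Proof.
move=> a b c; rewrite -(wreprK a) -(wreprK b) -(wreprK c).
by rewrite -!wclass_of_cat catA.
Qed.

Lemma wclass_mul1 : left_id wclass_one wclass_mul.
Proof. by move=> a; rewrite -(wreprK a) -wclass_of_cat. Qed.

Lemma wclass_mulr1 : right_id wclass_one wclass_mul.
Proof. by move=> a; rewrite -(wreprK a) -wclass_of_cat cats0. Qed.

HB.instance Definition _ := isMonoid.Build (wclass X k)
  wclass_mulA wclass_mul1 wclass_mulr1.

Lemma wclass_ofM u v : wclass_of (u ++ v) = wclass_of u * wclass_of v.
Proof. exact: wclass_of_cat. Qed.

Lemma wclass_of_wpow u n : wclass_of (wpow u n) = wclass_of u ^+ n.
Proof. by elim: n => // n IH; rewrite wpowS wclass_ofM IH expgS. Qed.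

End WordClasses.

Lemma wclass_aperiodic (X : finType) (k : nat) : aperiodic (wclass X k).
Proof.
exists (pow_index k) => c; rewrite -(wreprK c) -!wclass_of_wpow.
by apply/wclass_ofP/weq_wpow.
Qed.

(** * Values of equivalent words in a monoid *)

Section Evaluation.
Variable M : finMonoidType.
Implicit Types (u v w x y : seq M) (A B : powset M).

Definition weval w : M := \prod_(x <- w) x.

Lemma weval_cat u v : weval (u ++ v) = weval u * weval v.
Proof. exact: big_cat. Qed.

(** A fibre of the relational morphism [word_rel], by [rel_preim_word]; it can only shrink as [k]
    grows. *)
Definition wpreim k w : powset M :=
  [set m | `[< exists2 x, x =[k]= w & weval x = m >]].

Lemma wpreimP k w m : reflect (exists2 x, x =[k]= w & weval x = m) (m \in wpreim k w).
Proof. by rewrite inE; apply: asboolP. Qed.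

Lemma eq_wpreim k u v : u =[k]= v -> wpreim k u = wpreim k v.
Proof.
move=> e; apply/setP=> m; apply/wpreimP/wpreimP => -[x ex <-]; exists x => //.
  exact: weq_trans e.
exact: weq_trans (weq_sym e).
Qed.

Lemma wpreim_leq j k w : j <= k -> wpreim k w \subset wpreim j w.
Proof.
by move=> lejk; apply/subsetP=> m /wpreimP[x /(weq_leq lejk) ex <-]; apply/wpreimP; exists x.
Qed.

Lemma wpreim_nil k : wpreim k [::] = 1.
Proof.
apply/setP=> m; rewrite in_set1; apply/wpreimP/eqP => [[x /weq_nil-> <-] | ->].
  by rewrite /weval big_nil.
by exists [::]; rewrite // /weval big_nil.
Qed.

Lemma wpreim_catl k u v : wpreim k u * wpreim k v \subset wpreim k (u ++ v).
Proof.
apply/subsetP=> _ /imset2P[_ _ /wpreimP[x ex <-] /wpreimP[y ey <-] ->].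
by apply/wpreimP; exists (x ++ y); [apply: weq_cat | rewrite weval_cat].
Qed.

(** A word equivalent to [u ++ v] can be cut accordingly, but only one level down. Levels at which
    the sets are stable will make up for this loss. *)
Lemma wpreim_catr k u v : wpreim k.+1 (u ++ v) \subset wpreim k u * wpreim k v.
Proof.
apply/subsetP=> _ /wpreimP[z /weq_sym ez <-].
have [x [y [-> ex ey]]] := weq_cut ez.
rewrite weval_cat; apply/imset2P; exists (weval x) (weval y) => //.
  by apply/wpreimP; exists x => //; apply: weq_sym.
by apply/wpreimP; exists y => //; apply: weq_sym.
Qed.

(** The inverse of [weval] followed by the projection to classes. Testing the definitions of
    pointlike sets and of triples on it turns them into facts about words. *)
Definition word_rel k (m : M) : powset (wclass M k) :=
  [set c | `[< exists2 w, wclass_of k w = c & weval w = m >]].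

Lemma word_relP k m c :
  reflect (exists2 w, wclass_of k w = c & weval w = m) (c \in word_rel k m).
Proof. by rewrite inE; apply: asboolP. Qed.

Lemma word_relation k : relational_morphism (@word_rel k).
Proof.
split=> [m||m m'].
- apply/set0Pn; exists (wclass_of k [:: m]); apply/word_relP; exists [:: m] => //.
  by rewrite /weval big_seq1.
- by apply/word_relP; exists [::] => //; rewrite /weval big_nil.
apply/subsetP=> _ /imset2P[_ _ /word_relP[u <- <-] /word_relP[v <- <-] ->].
by apply/word_relP; exists (u ++ v); rewrite ?wclass_ofM ?weval_cat.
Qed.

Lemma rel_preim_word k w : rel_preim (@word_rel k) (wclass_of k w) = wpreim k w.
Proof.
apply/setP=> m; rewrite inE; apply/word_relP/wpreimP => -[x ex <-]; exists x => //.
  exact/wclass_ofP.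
exact/wclass_ofP.
Qed.

End Evaluation.

(** * From words to triples *)

Lemma powset_mulS (M : finMonoidType) (A A' B B' : powset M) :
  A \subset A' -> B \subset B' -> A * B \subset A' * B'.
Proof. by move=> sA sB; apply: imset2S. Qed.

Section RelPreim.
Variables (M N : finMonoidType) (phi : M -> powset N).
Hypothesis phi_rel : relational_morphism phi.
Implicit Types A B : powset M.

Lemma rel_preimM A B a b : A \subset rel_preim phi a -> B \subset rel_preim phi b ->
  A * B \subset rel_preim phi (a * b).
Proof.
case: phi_rel => _ _ phiM /subsetP sA /subsetP sB.
apply/subsetP=> _ /imset2P[x y /sA + /sB + ->]; rewrite !inE => ax bY.
by apply: (subsetP (phiM x y)); apply/imset2P; exists a b.
Qed.

Lemma rel_preimX A a n : A \subset rel_preim phi a -> A ^+ n \subset rel_preim phi (a ^+ n).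
Proof.
move=> sA; elim: n => [|n IH]; last by rewrite !expgS; apply: rel_preimM.
by case: phi_rel => _ phi1 _; apply/subsetP=> x /set1P->; rewrite inE.
Qed.

End RelPreim.

Lemma aperiodic_exp (N : finMonoidType) :
  aperiodic N -> exists n, forall (x : N) m, n <= m -> x ^+ m = x ^+ n.
Proof.
case=> n xn; exists n => x m /subnKC <-; elim: (m - n)%N => [|d IH].
  by rewrite addn0.
by rewrite addnS expgSr IH -expgSr xn.
Qed.

Lemma V_triple_sub V (M : finMonoidType) (A A' B B' C C' : powset M) :
  A \subset A' -> B \subset B' -> C \subset C' -> V_triple V A' B' C' -> V_triple V A B C.
Proof.
move=> sA sB sC tr N phi VN rphi; have [a [b [c [ha hb hc e]]]] := tr N phi VN rphi.
by exists a, b, c; split=> //; apply: subset_trans; eassumption.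
Qed.

Definition stabilizing_triple (M : finMonoidType) (A B C : powset M) : Prop :=
  [/\ pointlike aperiodic A, pointlike aperiodic B, pointlike aperiodic C &
      [\/ B * C = B,
          exists T : powset M,
            [/\ pointlike aperiodic T, A * B * T = A & C = T * B]
        | exists (S T : powset M) (i : nat),
            [/\ pointlike aperiodic S, pointlike aperiodic T & (1 <= i)%N] /\
            [/\ A = A * T * S, B = (T * S) ^+ i * T & C = S * T]]].

Lemma mulg_fix_exp (G : monoidType) (x y : G) n : x * y = x -> x * y ^+ n = x.
Proof. by move=> e; elim: n => [|n IH]; rewrite ?mulg1 // expgS mulgA e. Qed.

(** Each equation says that a set is unchanged by some factor. The element chosen for this set may
    therefore be multiplied by a high power of the element chosen for the factor, and in an
    aperiodic [N] this power absorbs one more factor. *)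
Lemma stabilizing_triple_A (M : finMonoidType) (A B C : powset M) :
  stabilizing_triple A B C -> V_triple aperiodic A B C.
Proof.
case=> plA plB plC cases N phi apN rphi.
have [n absorb] := aperiodic_exp apN.
have [a sA] := plA N phi apN rphi; have [b sB] := plB N phi apN rphi.
case: cases => [BC | [T [plT ABT ->]] | [S [T [i [[plS plT i_gt0] [ATS -> ->]]]]]].
- have [c sC] := plC N phi apN rphi.
  exists a, (b * c ^+ n), c; split=> //.
    by rewrite -[B](mulg_fix_exp n BC); apply: rel_preimM => //; apply: rel_preimX.
  by rewrite -!mulgA -expgSr absorb.
- have [t sT] := plT N phi apN rphi.
  have sBT : B * T \subset rel_preim phi (b * t) by apply: rel_preimM.
  exists (a * (b * t) ^+ n), b, (t * b); split=> //; last 1 first.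
  + have -> : a * (b * t) ^+ n * b * (t * b) = a * ((b * t) ^+ n * (b * t)) * b.
      by rewrite !mulgA.
    by rewrite -expgSr absorb.
  + rewrite -[A](@mulg_fix_exp _ _ (B * T) n); last by rewrite mulgA.
    by apply: rel_preimM => //; apply: rel_preimX.
  + exact: rel_preimM.
have [s sS] := plS N phi apN rphi; have [t sT] := plT N phi apN rphi.
have sTS : T * S \subset rel_preim phi (t * s) by apply: rel_preimM.
exists (a * (t * s) ^+ n), ((t * s) ^+ i * t), (s * t); split.
- rewrite -[A](@mulg_fix_exp _ _ (T * S) n); last by rewrite mulgA.
  by apply: rel_preimM => //; apply: rel_preimX.
- by apply: rel_preimM => //; apply: rel_preimX.
- exact: rel_preimM.
have Dabc x y : a * x * (y * t) * (s * t) = a * (x * y * (t * s)) * t.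
  by rewrite !mulgA.
have Dab x y : a * x * (y * t) = a * (x * y) * t by rewrite !mulgA.
rewrite Dabc Dab -expgnDr -expgSr.
by rewrite (@absorb _ (n + i).+1) ?(@absorb _ (n + i)) // ?leqW ?leq_addr.
Qed.

(** * The three systems of equations between words *)

Section Trichotomy.
Variable X : finType.
Implicit Types u v w p q t x y : seq X.

(* As long as the cut (p, w) of [p ++ w] falls beyond t, a factor t can be split off p. *)
Lemma weq_descent K t w n p : p ++ w =[K + n]= t ++ p ->
  (exists q x i, [/\ t =[K]= x ++ q, w =[K]= q ++ x & p =[K]= wpow t i ++ x]) \/
  exists x, p =[K]= wpow t n ++ x.
Proof.
elim: n p => [|n IH] p; first by right; exists p.
rewrite addnS => /weq_cut [x [y [/cat_eq_cat Dxy ex ey]]].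
have leK : K <= K + n by rewrite leq_addr.
(* If the transferred cut falls beyond [t], then [p] is equivalent to [t ++ r] and [r] satisfies the
   hypothesis one level down. *)
case: Dxy => -[r [Dx Dy]].
  have e1 : r ++ w =[K + n]= t ++ r.
    apply: (@weq_trans _ _ _ p); last by rewrite -Dx.
    by rewrite Dy; apply: weq_cat.
  have ep : p =[K]= t ++ r by rewrite -Dx; apply: weq_leq ex.
  case: (IH _ e1) => [[q [z [i [et ew er]]]] | [z er]].
    left; exists q, z, i.+1; split=> //; apply: weq_trans ep _.
    by rewrite wpowS -catA; apply: weq_cat.
  right; exists z; apply: weq_trans ep _.
  by rewrite wpowS -catA; apply: weq_cat.
(* If it falls inside [t], then [t] and [w] are conjugate up to equivalence: [t] is [p ++ r] and [w]
   is [r ++ p]. *)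
left; exists r, p, 0%N; split=> //.
  by rewrite Dx; apply: weq_cat => //; apply/weq_sym/(weq_leq leK).
by rewrite -Dy; apply: weq_leq ey.
Qed.

(** The outcome depends on where the cut of [u ++ v] falls in [u ++ v ++ w], and on the number of
    factors [t] that can be split off [v]. *)
Lemma weq_trichotomy K u v w : u ++ v ++ w =[(K + pow_index K).+2]= u ++ v ->
  [\/ v ++ w =[K]= v,
      exists p, u =[K]= u ++ v ++ p /\ w =[K]= p ++ v
    | exists p q i, [/\ u =[K]= u ++ p ++ q, v =[K]= wpow (p ++ q) i.+1 ++ p
                      & w =[K]= q ++ p]].
Proof.
set n := pow_index K => /weq_sym/weq_cut [x [y [/cat_eq_cat Dxy ex ey]]].
have leK : K <= (K + n).+1 by rewrite leqW ?leq_addr.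
case: Dxy => -[t [Dx Dy]]; last first.
  (* The cut falls within [u]. Then [v] can be pumped by [t] on the left and [w] on the right, and
     the high power of [w] absorbs a further [w]. *)
  apply: Or31; have ev : v =[K]= t ++ v ++ w by rewrite -Dy; apply: weq_leq ey.
  have pump m : v =[K]= wpow t m ++ v ++ wpow w m.
    elim: m => [|m IH]; first by rewrite cats0.
    apply: weq_trans IH _; rewrite (wpowSr t) (wpowS w) -!catA.
    by apply: weq_cat => //; rewrite !catA; apply: weq_cat => //; rewrite -catA.
  apply: weq_trans (weq_sym (pump n)).
  apply: (@weq_trans _ _ _ ((wpow t n ++ v ++ wpow w n) ++ w)).
    exact: weq_cat.
  rewrite -!catA -wpowSr; do 2!apply: weq_cat => //.
  exact: weq_wpow.
(* The cut falls after [u]. Then [u] absorbs [t], and [v ++ w] is equivalent to [t ++ v], as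
   [weq_descent] requires. *)
have eu : u =[K]= u ++ t by rewrite -Dx; apply: weq_leq ex.
have e1 : v ++ w =[(K + n).+1]= t ++ v.
  by rewrite Dy; apply: weq_cat => //; apply: weq_sym.
have evw : v ++ w =[K]= t ++ v by apply: weq_leq e1.
(* If [n] factors [t] can be split off, their power absorbs the additional [t] of [t ++ v], which
   gives the first system. Otherwise [i = 0] leads to the second system and [i > 0] to the third. *)
case: (weq_descent (weqW e1)) => [[q [p [i [et ew ev]]]] | [p ev]]; last first.
  apply: Or31; apply: weq_trans evw _; apply: weq_trans (weq_sym ev).
  apply: (@weq_trans _ _ _ (wpow t n.+1 ++ p)).
    by rewrite wpowS -catA; apply: weq_cat.
  by apply: weq_cat => //; apply: weq_wpow.
have eu' : u =[K]= u ++ p ++ q by apply: weq_trans eu _; apply: weq_cat.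
case: i ev => [|i] ev; last first.
  apply: Or33; exists p, q, i; split=> //.
  by apply: weq_trans ev _; apply: weq_cat => //; apply: weq_flatten_nseq.
apply: Or32; exists q; split; last first.
  by apply: weq_trans ew _; apply: weq_cat => //; apply: weq_sym.
by apply: weq_trans eu' _; apply: weq_cat => //; apply: weq_cat.
Qed.

End Trichotomy.

(** * From equations between words to equations between sets *)

Section StableWindow.
Variable M : finMonoidType.
Implicit Types (u v w x y z t p q : seq M) (ws : seq (seq M)).

Lemma wpreim_flatten_sup k ws :
  \prod_(w <- ws) wpreim k w \subset wpreim k (flatten ws).
Proof.
elim: ws => [|w ws IH] /=; first by rewrite big_nil wpreim_nil.
by rewrite big_cons; apply: subset_trans (wpreim_catl _ _ _); apply: powset_mulS.
Qed.

Lemma wpreim_flatten_sub k ws :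
  wpreim (k + size ws) (flatten ws) \subset \prod_(w <- ws) wpreim k w.
Proof.
elim: ws => [|w ws IH] /=; first by rewrite big_nil wpreim_nil.
rewrite big_cons addnS; apply: subset_trans (wpreim_catr _ _ _) _.
by apply: powset_mulS => //; apply: wpreim_leq; rewrite leq_addr.
Qed.

(** Cutting into factors costs one level per factor. The cuts are made at level [k], where the set
    of [w] is the same as at level [j]. *)
Lemma wpreim_flatten_stable j k w ws : j + size ws <= k ->
  wpreim k w = wpreim j w -> w =[k]= flatten ws ->
  wpreim j w = \prod_(x <- ws) wpreim j x.
Proof.
move=> lek st e; apply/eqP; rewrite eqEsubset; apply/andP; split.
  rewrite -st (eq_wpreim e); apply: subset_trans (wpreim_flatten_sub _ _).
  exact: wpreim_leq.
have lejk : j <= k by apply: leq_trans lek; rewrite leq_addr.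
by rewrite (eq_wpreim (weq_leq lejk e)); apply: wpreim_flatten_sup.
Qed.

Lemma bounded_stable (f : nat -> nat) b : (forall j, f j.+1 <= f j) -> f 0 <= b ->
  exists2 j, j <= b & f j.+1 = f j.
Proof.
elim: b f => [|b IH] f nincr f0.
  by exists 0%N => //; move: (nincr 0%N) f0; lia.
case: (eqVneq (f 1%N) (f 0%N)) => [e|ne]; first by exists 0%N.
have [||j lej ej] := IH (fun j => f j.+1); first by move=> j; apply: nincr.
  by move: (nincr 0%N) ne f0; lia.
by exists j.+1.
Qed.

(* The step is chosen so that a word equal at level [window k0 j.+1] to a product of
   at most 2i+1 factors, with i the power index one level above [window k0 j], can
   be cut into these factors at level [window k0 j]. *)
Fixpoint window k0 j :=
  if j is j'.+1 then window k0 j' + (pow_index (window k0 j').+1).*2.+3 else k0.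

Lemma window_leq k0 i j : i <= j -> window k0 i <= window k0 j.
Proof.
by move/subnK<-; elim: (j - i) => //= d IH; apply: leq_trans IH _; rewrite leq_addr.
Qed.

(** The sum of the cardinalities of the sets does not increase from one window to the next and
    starts at [size ws * #|M|] at most. When it stays the same, so does each cardinality, hence each
    set. *)
Lemma stable_window k0 ws : exists2 j, j <= size ws * #|M| &
  forall w, w \in ws -> wpreim (window k0 j.+1) w = wpreim (window k0 j) w.
Proof.
pose f j := (\sum_(w <- ws) #|wpreim (window k0 j) w|)%N.
have le_card j w : #|wpreim (window k0 j.+1) w| <= #|wpreim (window k0 j) w|.
  by apply/subset_leq_card/wpreim_leq/window_leq.
have [||j lej ej] := @bounded_stable f (size ws * #|M|).
- by move=> j; apply: leq_sum => w _; apply: le_card.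
- rewrite /f -sum1_size big_distrl /=; apply: leq_sum => w _.
  by rewrite mul1n max_card.
exists j => // w w_ws; apply/eqP; rewrite eqEcard wpreim_leq ?window_leq //=.
have: (\sum_(w <- ws) (#|wpreim (window k0 j) w| - #|wpreim (window k0 j.+1) w|) = 0)%N.
  by rewrite sumnB //; move: ej; rewrite /f => ->; rewrite subnn.
move/eqP; rewrite sum_nat_seq_eq0 => /allP /(_ _ w_ws); rewrite /= subn_eq0.
by [].
Qed.

(** The equations between words hold at level [K], hence at all lower levels. Below [K] there are
    two consecutive windows between which the sets of [u], [v] and [w] do not change, and there the
    equations pass to the sets. *)
Lemma weq_stabilizing k0 u v w :
  (forall x, pointlike aperiodic (wpreim k0 x)) ->
  let K := window k0 (5 * #|M|).+1 in
  u ++ v ++ w =[(K + pow_index K).+2]= u ++ v ->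
  exists k, [/\ k <= K & stabilizing_triple (wpreim k u) (wpreim k v) (wpreim k w)].
Proof.
move=> plk0 K e.
have [p [q tri]] : exists p q, [\/ v ++ w =[K]= v,
      u =[K]= u ++ v ++ p /\ w =[K]= p ++ v
    | exists i, [/\ u =[K]= u ++ p ++ q, v =[K]= wpow (p ++ q) i.+1 ++ p
                      & w =[K]= q ++ p]].
  case: (weq_trichotomy e) => [e1 | [p e2] | [p [q e3]]].
  - by exists [::], [::]; apply: Or31.
  - by exists p, [::]; apply: Or32.
  - by exists p, q; apply: Or33.
(* For five words the index [j] is at most [5 * #|M|], so that [K] lies at or above the window
   [j.+1]. *)
have [j lej st] := stable_window k0 [:: u; v; w; p; q].
pose k := window k0 j; pose k' := window k0 j.+1.
have lek'K : k' <= K by apply: window_leq.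
have Dk' : k' = (k + (pow_index k.+1).*2.+3)%N by [].
have lekk' : k < k' by rewrite Dk'; lia.
have ple x : pointlike aperiodic (wpreim k x).
  move=> N phi apN rphi; have [n sn] := plk0 x N phi apN rphi.
  by exists n; apply: subset_trans sn; apply/wpreim_leq/(@window_leq _ 0).
have stu : wpreim k' u = wpreim k u by apply: st; rewrite !inE eqxx.
have stv : wpreim k' v = wpreim k v by apply: st; rewrite !inE eqxx ?orbT.
have stw : wpreim k' w = wpreim k w by apply: st; rewrite !inE eqxx ?orbT.
exists k; split; first by apply: leq_trans lek'K; apply: ltnW.
split=> //.
have prod2 x y z : x =[k']= y ++ z -> wpreim k' x = wpreim k x ->
    wpreim k x = wpreim k y * wpreim k z.
  move=> ex sx; rewrite (@wpreim_flatten_stable k k' x [:: y; z]) //= ?cats0 //.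
    by rewrite !big_cons big_nil mulg1.
  by rewrite Dk'; lia.
have prod3 : forall x y z t, x =[k']= y ++ z ++ t -> wpreim k' x = wpreim k x ->
    wpreim k x = wpreim k y * wpreim k z * wpreim k t.
  move=> x y z t ex sx.
  rewrite (@wpreim_flatten_stable k k' x [:: y; z; t]) //= ?cats0 //.
    by rewrite !big_cons big_nil mulg1 mulgA.
  by rewrite Dk'; lia.
have caseI : v ++ w =[k.+1]= v -> wpreim k v * wpreim k w = wpreim k v.
  move=> evw; apply/eqP; rewrite eqEsubset; apply/andP; split.
    by rewrite -{2}(eq_wpreim (weqW evw)) wpreim_catl.
  rewrite -{1}stv; apply: subset_trans (wpreim_catr _ _ _).
  by rewrite (eq_wpreim evw) wpreim_leq.
case: tri => [evw | [eu ew] | [i [eu ev ew]]].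
- by apply/Or31/caseI/(weq_leq _ evw)/(leq_trans lekk').
- apply: Or32; exists (wpreim k p); split=> //.
    by apply/esym/prod3 => //; apply: weq_leq eu.
  by apply: prod2 => //; apply: weq_leq ew.
(* A large power has too many factors to be cut within the window, but it absorbs one more [p ++ q],
   and the first system holds instead. *)
have [lei|gti] := leqP (pow_index k.+1) i.
  apply/Or31/caseI; have leK : k.+1 <= K by apply: leq_trans lek'K.
  apply: weq_trans (weq_sym (weq_leq leK ev)).
  apply: (@weq_trans _ _ _ (wpow (p ++ q) i.+2 ++ p)).
    apply: (@weq_trans _ _ _ ((wpow (p ++ q) i.+1 ++ p) ++ (q ++ p))).
      by apply: weq_cat; apply: weq_leq leK _.
    by rewrite [wpow _ i.+2]wpowSr -!catA.
  by apply: weq_cat => //; apply: weq_wpow_leq; lia.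
apply: Or33; exists (wpreim k q), (wpreim k p), i.+1; split=> //; split.
- by apply: prod3 => //; apply: weq_leq eu.
- pose ws := flatten (nseq i.+1 [:: p; q]) ++ [:: p].
  have Dws n : flatten (flatten (nseq n [:: p; q]) ++ [:: p]) = wpow (p ++ q) n ++ p.
    by elim: n => [|n IH] /=; rewrite ?cats0 // IH wpowS -!catA.
  have size_ws n : size (flatten (nseq n [:: p; q]) ++ [:: p]) = (n.*2.+1)%N.
    by elim: n => //= n ->.
  rewrite (@wpreim_flatten_stable k k' v ws) //.
  + rewrite /ws big_cat big_seq1; congr (_ * _).
    elim: i.+1 => [|n IH] /=; first by rewrite big_nil.
    by rewrite !big_cons IH expgS -mulgA.
  + by rewrite size_ws Dk'; lia.
  by rewrite Dws; apply: weq_leq ev.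
by apply: prod2 => //; apply: weq_leq ew.
Qed.

(** The triple is tested on the quotient at the level that [weq_stabilizing] asks for. The sets
    obtained at the lower level [k] contain the fibres at that level. *)
Lemma A_triple_stabilizing k0 (A B C : powset M) :
  (forall x : seq M, pointlike aperiodic (wpreim k0 x)) ->
  V_triple aperiodic A B C ->
  exists A' B' C' : powset M, [/\ A \subset A', B \subset B', C \subset C'
                     & stabilizing_triple A' B' C'].
Proof.
move=> plk0 tr; pose K := window k0 (5 * #|M|).+1.
have [a [b [c]]] := tr _ _ (wclass_aperiodic M (K + pow_index K).+2) (word_relation M _).
rewrite -(wreprK a) -(wreprK b) -(wreprK c).
rewrite -(wclass_ofM _ (wrepr a) (wrepr b)) -(wclass_ofM _ _ (wrepr c)) !rel_preim_word.
move: (wrepr a) (wrepr b) (wrepr c) => u v w [sA sB sC /wclass_ofP].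
rewrite -catA => e; have [k [lek st]] := weq_stabilizing plk0 e.
exists (wpreim k u), (wpreim k v), (wpreim k w).
have leK : k <= (K + pow_index K).+2 by apply: leq_trans lek _; rewrite -/K; lia.
by split=> //; apply: subset_trans (wpreim_leq _ leK); eassumption.
Qed.

End StableWindow.

(** * Factorization into blocks *)

Section WordPredicates.
Variable X : finType.
Implicit Types (u v : seq X).

Lemma weq_mem k u v : u =[k.+1]= v -> u =i v.
Proof.
have sub u' v' : u' =[k.+1]= v' -> {subset u' <= v'}.
  move=> e c /path.splitPr uc; case: uc e => u1 u2 /weq_cut[x [y [-> _ /weq_ohead]]].
  by case: y => //= d y [->]; rewrite mem_cat mem_head orbT.
by move=> e c; apply/idP/idP; apply: sub.
Qed.

Lemma weq_last k a u v : u =[k.+2]= v -> last a u = last a v.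
Proof.
case/lastP: u => [/weq_sym/weq_nil-> // | u c].
rewrite -cats1 => /weq_cut[x [y [-> _ /(@weq_short _ _ [:: c])<- //]]].
by rewrite !cats1 !last_rcons.
Qed.

End WordPredicates.

Section Blocks.
Variables (X : finType) (a : X).
Implicit Types (u v w x y : seq X) (j : nat) (b : seq X * nat) (bs : seq (seq X * nat)).

(* A block (v, j) stands for the word v a^(j+1), where v is non-empty and has no a. *)
Definition block_word b := b.1 ++ nseq b.2.+1 a.
Definition blocks_word bs := flatten (map block_word bs).
Definition block b := (b.1 != [::]) && (a \notin b.1).

Lemma blocks_word_cat bs1 bs2 :
  blocks_word (bs1 ++ bs2) = blocks_word bs1 ++ blocks_word bs2.
Proof. by rewrite /blocks_word map_cat flatten_cat. Qed.

Lemma blocks_word_nil bs : blocks_word bs = [::] -> bs = [::].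
Proof. by case: bs => // -[[|c v] j]. Qed.

Lemma last_nseq_a n : last a (nseq n a) = a.
Proof. by elim: n. Qed.

Lemma blocks_word_last bs : last a (blocks_word bs) = a.
Proof.
elim/last_ind: bs => // bs b _; rewrite -cats1 blocks_word_cat last_cat.
by rewrite /blocks_word /= cats0 /block_word last_cat /= last_nseq_a.
Qed.

Lemma blocks_word_head bs : all block bs -> ohead (blocks_word bs) != Some a.
Proof.
case: bs => [|[[|c v] j] bs] //= /andP[]; rewrite /block /= inE negb_or.
by case/andP=> ac _ _; apply: contraNneq ac => -[->].
Qed.

Lemma block_decomposition w : exists t : nat * seq (seq X * nat) * seq X,
  [/\ w = nseq t.1.1 a ++ blocks_word t.1.2 ++ t.2, all block t.1.2 & a \notin t.2].
Proof.
elim: w => [|c w [[[j bs] v] /= [-> bsP vP]]]; first by exists (0%N, [::], [::]).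
have [->|ca] := eqVneq c a; first by exists (j.+1, bs, v).
case: j => [|j]; last first.
  exists (0%N, ([:: c], j) :: bs, v); split; rewrite //= ?bsP ?andbT.
    by rewrite -catA.
  by rewrite /block inE (eq_sym a) ca.
case: bs bsP => [|[u j] bs] /= bsP.
  by exists (0%N, [::], c :: v); split; rewrite //= inE negb_or (eq_sym a) ca.
case/andP: bsP => /andP[/= _ au] bsP.
exists (0%N, (c :: u, j) :: bs, v); split; rewrite //= bsP andbT.
by rewrite /block /= inE negb_or (eq_sym a) ca.
Qed.

(** An [a] that is not followed by [a] is the end of a block. The default of [last] admits an empty
    [x], and [ohead] admits an empty [y]. *)
Lemma blocks_word_split bs x y : all block bs -> blocks_word bs = x ++ y ->
  last a x = a -> ohead y != Some a ->
  exists bs1 bs2, [/\ bs = bs1 ++ bs2, x = blocks_word bs1 & y = blocks_word bs2].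
Proof.
elim: bs x => [|b bs IH] x /=.
  by case: x => //= _ /esym -> _ _; exists [::], [::].
case/andP=> bP bsP; rewrite [LHS]/= -/(blocks_word bs).
case/cat_eq_cat=> -[r [Dx Dy]] lastx heady.
  have [|bs1 [bs2 [-> Dr ->]]] := IH r bsP Dy _ heady.
    by move: lastx; rewrite Dx last_cat /block_word last_cat /= last_nseq_a.
  by exists (b :: bs1), bs2; rewrite Dx Dr.
case: r Dx Dy heady => [|c r] Dx Dy heady.
  by exists [:: b], bs; split; rewrite // /blocks_word /= cats0 Dx cats0.
case: x Dx lastx => [|d x] Dx lastx.
  by exists [::], (b :: bs); split; rewrite // Dy -[c :: r]Dx.
case/andP: bP => _ /negP[]; move: Dx; rewrite /block_word => /cat_eq_cat[] [s [Ds Dr]].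
  have: c \in nseq b.2.+1 a by rewrite Dr mem_cat mem_head orbT.
  by rewrite mem_nseq => /eqP Dc; rewrite Dy /= Dc eqxx in heady.
by rewrite Ds mem_cat -{1}lastx /= mem_last.
Qed.

End Blocks.

Section BlockCode.
Variables (X Y : finType) (a : X) (code : seq X * nat -> Y) (c : nat).
Hypothesis code_eq : forall v j v' j', v =[c]= v' -> nseq j.+1 a =[c]= nseq j'.+1 a ->
  code (v, j) = code (v', j').
Implicit Types (bs : seq (seq X * nat)).

(** The boundaries of blocks are visible from the adjacent letters, so a cut between two blocks is
    answered by a cut between two blocks. In the base case the spare levels serve to cut off the
    first block, to cut it into its two parts, and to recognize these parts in the answer. *)
Lemma weq_blocks k bs bs' : all (block a) bs -> all (block a) bs' ->
  blocks_word a bs =[k + c.+4]= blocks_word a bs' ->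
  map code bs =[k]= map code bs'.
Proof.
elim: k bs bs' => [|k IH] bs bs'.
  rewrite add0n; case: bs => [|[v j] bs] bsP bsP' e.
    by move/weq_sym/weq_nil/blocks_word_nil: e => ->.
  have [x [y [Dxy ex ey]]] := weq_cut (u := block_word a (v, j)) (v := blocks_word a bs) e.
  case/andP: bsP => /andP[/= v0 av] bsP.
  have lastx : last a x = a.
    by rewrite -(weq_last _ ex) /block_word last_cat /= last_nseq_a.
  have heady : ohead y != Some a by rewrite -(weq_ohead ey) blocks_word_head.
  have [p [q [Dbs' Dx Dy]]] := blocks_word_split bsP' Dxy lastx heady.
  have [x1 [x2 [Dx12 ex1 ex2]]] := weq_cut ex.
  have ax1 : a \notin x1 by rewrite -(weq_mem ex1).
  have ax2 : {subset x2 <= pred1 a}.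
    by move=> d; rewrite -(weq_mem ex2) mem_nseq /= => /eqP->; apply: eqxx.
  (* The answer [x] is a single block: [x1] has no [a] and [x2] only [a], so they are the two parts
     of its first block, and no further block fits. *)
  case: p Dx Dbs' => [|[v' j'] p] Dx Dbs'.
    by move: Dx12; rewrite Dx /=; case: x1 ex1 {ax1} => // /weq_nil/eqP; rewrite (negPf v0).
  move: bsP'; rewrite Dbs' /= => /andP[/andP[/= _ av'] ]; rewrite all_cat => /andP[pP _].
  have [Dv' Dr] : v' = x1 /\ nseq j'.+1 a ++ blocks_word a p = x2.
    move: Dx12; rewrite Dx /blocks_word /= /block_word -catA.
    rewrite [(v', j').1]/= [(v', j').2]/= => /cat_eq_cat[] [r [Dx1 Dx2]].
      case: r Dx1 Dx2 ax1 => [|d r] ->; rewrite ?cats0 // => -[<- _].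
      by rewrite mem_cat mem_head orbT.
    case: r Dx1 Dx2 => [|d r] Dv' Dx2; first by rewrite Dv' cats0.
    case/negP: av'; rewrite Dv' mem_cat; have /eqP<- : d \in pred1 a.
      by apply: ax2; rewrite Dx2 mem_head.
    by rewrite mem_head orbT.
  have Dp : p = [::].
    case: p pP Dr {Dx Dbs'} => [|[[|d u] i] p] //= /andP[/andP[/= _]].
    rewrite inE negb_or => /andP[ad _] _ Dx2; case/eqP: ad; apply/esym/eqP.
    by apply: ax2; rewrite -Dx2 inE mem_cat mem_head !orbT.
  rewrite /weq /=; congr Some; apply: code_eq.
    by rewrite Dv'; do 2!apply: weqW.
  by move: Dr; rewrite Dp cats0 => ->; do 2!apply: weqW.
have half bs1 bs2 : all (block a) bs1 -> all (block a) bs2 ->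
   blocks_word a bs1 =[k.+1 + c.+4]= blocks_word a bs2 ->
   forall u v, map code bs1 = u ++ v ->
   exists x y, [/\ map code bs2 = x ++ y, u =[k]= x & v =[k]= y].
  move=> bsP1 bsP2 e u v Duv.
  have Du : u = map code (take (size u) bs1) by rewrite map_take Duv take_size_cat.
  have Dv : v = map code (drop (size u) bs1) by rewrite map_drop Duv drop_size_cat.
  move: bsP1 e; rewrite -{1 2}(cat_take_drop (size u) bs1) all_cat => /andP[tP dP].
  rewrite addSn blocks_word_cat => /weq_cut[x [y [Dxy ex ey]]].
  have lastx : last a x = a.
    by move: ex; rewrite !addnS => /(weq_last a) <-; rewrite blocks_word_last.
  have heady : ohead y != Some a by rewrite -(weq_ohead ey) blocks_word_head.
  have [p [q [Dbs2 Dx Dy]]] := blocks_word_split bsP2 Dxy lastx heady.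
  move: bsP2; rewrite Dbs2 all_cat => /andP[pP qP].
  exists (map code p), (map code q); rewrite map_cat; split=> //.
    by rewrite Du; apply: IH => //; rewrite -Dx.
  by rewrite Dv; apply: IH => //; rewrite -Dy.
move=> bsP bsP' e; apply: weqS => u v; first exact: half e _ _.
exact: half (weq_sym e) _ _.
Qed.

(** Both cuts can be recognized in an equivalent word: the first separates a power of [a] from a
    word not starting with [a], the second a word that is empty or ends with [a] from a word without
    [a]. So the answers are the corresponding cuts of the other factorization. *)
Lemma weq_decomposition k j bs v j' bs' v' :
    all (block a) bs -> a \notin v -> all (block a) bs' -> a \notin v' ->
  nseq j a ++ blocks_word a bs ++ v =[k.+4]= nseq j' a ++ blocks_word a bs' ++ v' ->
  [/\ nseq j a =[k]= nseq j' a, blocks_word a bs =[k]= blocks_word a bs'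
    & v =[k]= v'].
Proof.
move=> bsP av bsP' av' /weq_cut[x [y [Dxy ex ey]]].
have ax : {subset x <= pred1 a}.
  by move=> d; rewrite -(weq_mem ex) mem_nseq /= => /andP[_]/eqP->; apply: eqxx.
have head_cat u w : a \notin w -> ohead u != Some a -> ohead (u ++ w) != Some a.
  case: u => //; case: w => //= d w; rewrite inE negb_or => /andP[ad _] _.
  by apply: contraNneq ad => -[->].
have heady : ohead y != Some a by rewrite -(weq_ohead ey) head_cat ?blocks_word_head.
have headm : ohead (blocks_word a bs' ++ v') != Some a by rewrite head_cat ?blocks_word_head.
have [Dx Dy] : nseq j' a = x /\ blocks_word a bs' ++ v' = y.
  case/cat_eq_cat: Dxy => -[[|d r] [Dx Dy]]; rewrite ?cats0 in Dx; first by rewrite Dx.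
  - have /eqP Dd : d \in pred1 a by apply: ax; rewrite Dx mem_cat mem_head orbT.
    by move: headm; rewrite Dy Dd /= eqxx.
  - by rewrite Dx.
  have : d \in nseq j' a by rewrite Dx mem_cat mem_head orbT.
  by rewrite mem_nseq => /andP[_ /eqP Dd]; move: heady; rewrite Dy Dd /= eqxx.
rewrite -{}Dx in ex; have {}ex : nseq j a =[k]= nseq j' a by do 3!apply: weqW.
rewrite -{}Dy in ey; have [x2 [y2 [Dxy2 ex2 ey2]]] := weq_cut ey.
have ay2 : a \notin y2 by rewrite -(weq_mem ey2).
have lastx2 : last a x2 = a by rewrite -(weq_last _ ex2) blocks_word_last.
have last_in (r : seq X) : r != [::] -> last a r = a -> a \in r.
  by case: r => // d r _ /= <-; apply: mem_last.
have [Dx2 Dy2] : blocks_word a bs' = x2 /\ v' = y2.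
  case/cat_eq_cat: Dxy2 => -[[|d r] [Dx Dy]]; rewrite ?cats0 in Dx; try by rewrite Dx.
    case/negP: av'; rewrite Dy mem_cat last_in //.
    by move: lastx2; rewrite Dx last_cat blocks_word_last.
  case/negP: ay2; rewrite Dy mem_cat last_in //.
  by have := blocks_word_last a bs'; rewrite Dx last_cat lastx2.
by rewrite Dx2 Dy2; split=> //; do 2!apply: weqW.
Qed.

End BlockCode.

(** * Henckell's theorem *)

Lemma exp_period (G : finMonoidType) (x : G) : exists i p,
  [/\ 0 < p, i + p <= #|G| & forall m q, i <= m -> x ^+ (m + q * p)%N = x ^+ m].
Proof.
have /injectivePn [i [j neq_ij eq_ij]] : ~~ injectiveb (fun i : 'I_#|G|.+1 => x ^+ i).
  by apply/injectiveP => /leq_card; rewrite card_ord ltnn.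
wlog lt_ij : i j neq_ij eq_ij / i < j.
  move=> th; case: (ltngtP i j) => [|lt_ji|/val_inj e]; first exact: th.
    by apply: (th j i) => //; rewrite eq_sym.
  by rewrite e eqxx in neq_ij.
exists i, (j - i)%N; split; first by rewrite subn_gt0.
  by rewrite subnKC ?(ltnW lt_ij) // -ltnS.
move=> m q /subnKC <-; rewrite -addnA (addnC (m - i)%N) addnA expgnDr.
rewrite [RHS]expgnDr; congr (_ * _); elim: q => [|q IH]; first by rewrite addn0.
by rewrite mulSn addnA subnKC ?(ltnW lt_ij) // expgnDr -eq_ij -expgnDr.
Qed.

(** The order of [G] bounds the preperiod and the period of [x], so its factorial is a multiple of
    the period. *)
Lemma exp_fact (G : finMonoidType) (x : G) m q :
  #|G| <= m -> x ^+ (m + q * #|G|`!)%N = x ^+ m.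
Proof.
move=> lem; have [i [p [p_gt0 le_ip xP]]] := exp_period x.
have /dvdnP[r ->] : p %| #|G|`!.
  by rewrite dvdn_fact // p_gt0 (leq_trans _ le_ip) // leq_addl.
by rewrite mulnA xP // (leq_trans _ lem) // (leq_trans _ le_ip) // leq_addr.
Qed.

Lemma prodg_nseq (G : monoidType) (x : G) n : \prod_(y <- nseq n x) y = x ^+ n.
Proof. by rewrite big_nseq iter_mulg_1. Qed.

Section PowerUnion.
Variable M : finMonoidType.
Implicit Types (a b x y z : powset M) (R F D : {set powset M}).

Definition pow_bound := #|{: powset M}|`!.

(* For x in powset M the power x^pow_bound is idempotent, so this is the union of
   all b^j with j >= pow_bound. *)
Definition power_union b : powset M :=
  [set m | [exists j : 'I_pow_bound, m \in b ^+ (pow_bound + j)]].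

Lemma pow_bound_card : #|{: powset M}| <= pow_bound.
Proof.
rewrite /pow_bound; have : 0 < #|{: powset M}| by apply/card_gt0P; exists 1.
by case: #|_| => // n _; rewrite factS leq_pmulr // fact_gt0.
Qed.

Lemma sub_power_union b j : b ^+ (pow_bound + j) \subset power_union b.
Proof.
apply/subsetP=> m; rewrite inE {1}(divn_eq j pow_bound) => mb; apply/existsP.
exists (Ordinal (ltn_pmod j (fact_gt0 _))) => /=; move: mb.
rewrite addnCA addnC exp_fact //.
by apply: leq_trans pow_bound_card _; apply: leq_addr.
Qed.

Lemma power_unionP b m :
  reflect (exists j, m \in b ^+ (pow_bound + j)) (m \in power_union b).
Proof.
apply: (iffP idP) => [|[j /(subsetP (sub_power_union _ _))] //].
by rewrite inE => /existsP[j mb]; exists j.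
Qed.

(** By periodicity each power in the union equals one with a larger exponent, from which a factor
    [b] can be taken off. *)
Lemma power_unionM b : power_union b * b = power_union b.
Proof.
apply/eqP; rewrite eqEsubset; apply/andP; split; apply/subsetP=> m.
  case/imset2P=> x y /power_unionP[j xb] yb ->; apply/power_unionP; exists j.+1.
  by rewrite addnS expgSr; apply/imset2P; exists x y.
case/power_unionP=> j mb.
have: m \in b ^+ (pow_bound + j + 1 * #|{: powset M}|`!)%N.
  by rewrite exp_fact // (leq_trans pow_bound_card) // leq_addr.
have Dp : pow_bound = pow_bound.-1.+1 by rewrite prednK ?fact_gt0.
rewrite mul1n -/pow_bound {2}Dp addnS expgSr.
case/imset2P=> x y xb yb ->; apply/imset2P; exists x y => //.
by apply/power_unionP; exists (j + pow_bound.-1)%N; rewrite addnA.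
Qed.

Definition saturated R :=
  (forall x y, x \in R -> y \in R -> x * y \in R) /\
  (forall x, x \in R -> power_union x \in R).

(** An upper bound in [R] for the product of a word over [D] that depends only on the class of the
    word. The empty word is set apart because [R] may lack 1. *)
Definition covered R D k (zeta : seq (powset M) -> powset M) :=
  [/\ zeta [::] = 1,
      forall w, all (mem D) w -> w != [::] -> zeta w \in R,
      forall w, all (mem D) w -> \prod_(x <- w) x \subset zeta w
    & forall w w', w =[k]= w' -> zeta w = zeta w'].

Definition rmuls R a : {set powset M} := [set r * a | r in R].

Lemma saturated_exp R b n : saturated R -> b \in R -> b ^+ n.+1 \in R.
Proof.
by case=> RM _ bR; elim: n => // n IH; rewrite expgS; apply: RM.
Qed.

Lemma rmuls_sub R a : saturated R -> a \in R -> rmuls R a \subset R.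
Proof. by case=> RM _ aR; apply/subsetP=> _ /imsetP[r rR ->]; apply: RM. Qed.

(** By [power_unionM] the set [power_union (r * a)] has a right factor [r * a], hence a right factor
    [a]. *)
Lemma rmuls_saturated R a : saturated R -> a \in R -> saturated (rmuls R a).
Proof.
case=> RM RU aR; split=> [_ _ /imsetP[r rR ->] /imsetP[s sR ->] | _ /imsetP[r rR ->]].
  by rewrite mulgA; apply: imset_f; rewrite !RM.
by rewrite -power_unionM mulgA; apply: imset_f; rewrite RM ?RU ?RM.
Qed.

(** Since [b] permutes [R], [y] is a multiple of high powers of [b] and is fixed by
    [b ^+ pow_bound]. So [y] is included in [y * power_union b], a member of [R], and by maximality
    they are equal; this product also contains [y * b]. *)
Lemma maximal_absorbs R a b y : saturated R -> b \in R -> rmuls R b = R ->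
  y \in R -> a \subset y ->
  (forall z, z \in R -> a \subset z -> #|z| <= #|y|) -> y * b \subset y.
Proof.
case=> RM RU bR Rb yR ay ymax.
have root n : exists2 r, r \in R & y = r * b ^+ n.
  elim: n => [|n [r]]; first by exists y; rewrite ?mulg1.
  by rewrite -{1}Rb => /imsetP[s sR ->] ->; exists s; rewrite // -mulgA -expgS.
have [r rR Dy] := root pow_bound.
have yb : y = y * b ^+ pow_bound.
  rewrite {2}Dy -mulgA -expgnDr -{2}(mul1n pow_bound) {2}/pow_bound exp_fact //.
  exact: pow_bound_card.
have yU : y \subset y * power_union b.
  by rewrite {1}yb -[pow_bound]addn0 powset_mulS ?sub_power_union.
have eyU : y = y * power_union b.
  apply/eqP; rewrite eqEcard yU ymax ?RM ?RU //; exact: subset_trans yU.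
rewrite {2}eyU {1}yb -mulgA -expgSr -addn1.
by rewrite powset_mulS ?sub_power_union.
Qed.

(* When each letter permutes R, a maximal member of R containing the first letter of
   a word absorbs all the other letters. *)
Lemma cover_permuting R D : saturated R -> D \subset R ->
  (forall a, a \in D -> rmuls R a = R) -> exists k zeta, covered R D k zeta.
Proof.
move=> satR /subsetP DR permR.
pose top a := [arg max_(y > a | (y \in R) && (a \subset y)) #|y|].
have topP a : a \in D -> [/\ top a \in R, a \subset top a &
    forall w, all (mem D) w -> top a * \prod_(x <- w) x \subset top a].
  move=> aD; rewrite /top; case: arg_maxnP; first by rewrite DR /=.
  move=> y /andP[yR ay] ymax; split=> // w; elim/last_ind: w => [|w b IH].
    by rewrite big_nil mulg1.
  rewrite all_rcons => /andP[/= bD wD]; rewrite -cats1 big_cat big_seq1 mulgA.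
  apply: subset_trans (powset_mulS (IH wD) (subxx b)) _.
  apply: (maximal_absorbs satR) yR ay _; rewrite ?DR ?permR //.
  by move=> z zR az; apply: ymax; rewrite zR.
(* Level 0 is enough, as the bound depends on the first letter only. *)
exists 0%N, (fun w => if w is a :: _ then top a else 1); split=> //.
- by case=> // a w /= /andP[/topP[]].
- case=> [|a w] /=; first by rewrite big_nil.
  case/andP=> /topP[_ ay absorb] wD; rewrite big_cons.
  by apply: subset_trans (absorb w wD); apply: powset_mulS.
by move=> [|a w] [|b w'] //= [->].
Qed.

(* Each block (v, j) is replaced by one letter, a member of R a that contains the
   values of all the words equivalent to the block. *)
Lemma cover_block R D a : saturated R -> D \subset R -> a \in D ->
  (exists k zeta, covered R (D :\ a) k zeta) ->
  (exists k zeta, covered (rmuls R a) (rmuls R a) k zeta) ->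
  exists k zeta, covered R D k zeta.
Proof.
move=> satR /subsetP DR aD [k1 [z1 [z1nil z1R z1sub z1eq]]] [k2 [z2 [z2nil z2R z2sub z2eq]]].
have [RM RU] := satR; have aR := DR a aD.
(* Exponents of [a] are distinguished below [pow_bound]; all larger powers share one bound. *)
pose alpha j := if j < pow_bound then a ^+ j else power_union a.
pose code (b : seq (powset M) * nat) := z1 b.1 * alpha b.2.+1.
have alphaR j : alpha j.+1 \in R.
  by rewrite /alpha; case: ifP => _; rewrite ?saturated_exp ?RU.
have alpha_sub j : a ^+ j \subset alpha j.
  rewrite /alpha; case: ltnP => // /subnKC <-; exact: sub_power_union.
have inD1 w : all (mem D) w -> a \notin w -> all (mem (D :\ a)) w.
  move=> /allP wD aw; apply/allP=> x xw; rewrite /= !inE [x \in D](wD x xw) andbT.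
  by apply: contraNneq aw => <-.
pose good (b : seq (powset M) * nat) := block a b && all (mem D) b.1.
have codeR (b : seq (powset M) * nat) : good b -> code b \in rmuls R a.
  case/andP=> /andP[b0 ab] bD; have z1b := z1R _ (inD1 _ bD ab) b0.
  (* In both cases [alpha b.2.+1] has a right factor [a]. *)
  rewrite /code /alpha; case: ifP => _; last first.
    by rewrite -power_unionM mulgA; apply: imset_f; rewrite RM ?RU.
  rewrite expgSr mulgA; apply: imset_f; case: b.2 => [|j]; first by rewrite mulg1.
  by rewrite RM // saturated_exp.
have goodP bs : all (block a) bs -> all (mem D) (blocks_word a bs) -> all good bs.
  elim: bs => //= b bs IH /andP[bP bsP]; rewrite /blocks_word /= all_cat /block_word all_cat.
  by case/andP=> /andP[bD _] bsD; rewrite /good bP bD IH.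
have codesR bs : all good bs -> all (mem (rmuls R a)) (map code bs).
  by move=> /allP bsP; rewrite all_map; apply/allP=> b /bsP/codeR.
have blocks_sub bs : all good bs ->
    \prod_(x <- blocks_word a bs) x \subset \prod_(x <- map code bs) x.
  elim: bs => [|b bs IH] /=; first by rewrite !big_nil.
  case/andP=> /andP[/andP[_ ab] bD] /IH sub; rewrite big_cat big_cons.
  apply: powset_mulS => //; rewrite /block_word big_cat; apply: powset_mulS.
    by apply/z1sub/inD1.
  by rewrite prodg_nseq; apply: alpha_sub.
have [parse parseP] := choice (block_decomposition a).
pose zeta w := alpha (parse w).1.1 * z2 (map code (parse w).1.2) * z1 (parse w).2.
have parseD w : all (mem D) w ->
    all good (parse w).1.2 /\ all (mem (D :\ a)) (parse w).2.
  have [Dw bsP av] := parseP w; rewrite {1}Dw !all_cat => /and3P[_ bsD vD].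
  by split; [apply: goodP | apply: inD1].
have alpha0 : alpha 0 = 1 by rewrite /alpha fact_gt0.
(* The outer four levels are spent by [weq_decomposition], the inner four by [weq_blocks]. The level
   [k1 + pow_bound] determines [z1] of the first part of a block as well as exponents below
   [pow_bound]. Words with a letter outside [D] get a constant value. *)
exists (k2 + (k1 + pow_bound).+4).+4, (fun w => if all (mem D) w then zeta w else 1).
split=> /=.
- have [e _ _] := parseP [::]; rewrite /zeta.
  case: (parse [::]) e => [[[|j] bs] [|c v]] //=.
    rewrite cats0 => /esym/blocks_word_nil->; rewrite alpha0 z2nil z1nil.
    by rewrite !mulg1.
  by move/(congr1 size); rewrite size_cat /= addnS.
- move=> w wD w0; rewrite wD; have [bsD vD] := parseD w wD; have [Dw _ _] := parseP w.
  rewrite /zeta; case: (parse w) => [[j bs] v] /= in bsD vD Dw *.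
  have bsR : bs != [::] -> z2 (map code bs) \in R.
    move=> bs0; apply: (subsetP (rmuls_sub satR aR)).
    by apply: z2R; [apply: codesR | case: (bs) bs0].
  have vR : v != [::] -> z1 v \in R by apply: z1R.
  (* An empty part contributes 1, which may be outside [R], so the cases are separated; one part is
     non-empty because [w] is. *)
  case: j Dw => [|j] Dw.
    rewrite alpha0 mul1g; case: eqVneq bsR => [bs0 _|_ bsR].
      rewrite bs0 z2nil mul1g; apply: vR.
      by apply: contraNneq w0 => v0; rewrite Dw bs0 v0.
    case: eqVneq vR => [-> _|_ vR]; last by rewrite RM ?bsR ?vR.
    by rewrite z1nil mulg1 bsR.
  case: eqVneq bsR => [-> _|_ bsR]; rewrite ?z2nil ?mulg1.
    case: eqVneq vR => [-> _|_ vR]; first by rewrite z1nil mulg1.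
    by rewrite RM ?vR.
  case: eqVneq vR => [-> _|_ vR]; first by rewrite z1nil mulg1 RM ?bsR.
  by rewrite !RM ?vR ?bsR.
- move=> w wD; rewrite wD; have [bsD vD] := parseD w wD; have [Dw _ _] := parseP w.
  rewrite {1}Dw !big_cat /= prodg_nseq mulgA /zeta; apply: powset_mulS; last exact: z1sub.
  apply: powset_mulS => //.
  by apply: subset_trans (blocks_sub _ bsD) _; apply/z2sub/codesR.
move=> w w' e; have allD : all (mem D) w' = all (mem D) w.
  by apply: eq_all_r => x; rewrite (weq_mem e).
rewrite allD; case: ifP => // wD; have wD' : all (mem D) w' by rewrite allD.
have [bsD vD] := parseD w wD; have [bsD' vD'] := parseD w' wD'.
have [Dw bsP av] := parseP w; have [Dw' bsP' av'] := parseP w'.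
rewrite {}Dw {}Dw' in e.
have [ej ebs ev] := weq_decomposition bsP av bsP' av' e.
(* By [weq_short] the two exponents are equal or both at least [pow_bound]. *)
have alpha_eq c j j' : pow_bound <= c -> nseq j a =[c]= nseq j' a -> alpha j = alpha j'.
  move=> lec ej'; rewrite /alpha.
  case: ltnP => [ltj|lej].
    have /(congr1 size) : nseq j a = nseq j' a.
      by apply: weq_short ej'; rewrite size_nseq (leq_trans (ltnW ltj)).
    by rewrite !size_nseq => <-; rewrite ltj.
  case: ltnP => // ltj'.
  have /(congr1 size) : nseq j' a = nseq j a.
    by apply: weq_short (weq_sym ej'); rewrite size_nseq (leq_trans (ltnW ltj')).
  by rewrite !size_nseq => Dj; rewrite -Dj leqNgt ltj' in lej.
have le_k k : k <= k1 + pow_bound -> k <= k2 + (k1 + pow_bound).+4.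
  by move=> lek; rewrite (leq_trans _ (leq_addl _ _)) // !leqW.
rewrite /zeta (alpha_eq _ _ _ (le_k _ (leq_addl _ _)) ej).
congr (_ * _ * _).
  apply: z2eq; apply: (weq_blocks (c := k1 + pow_bound)) bsP bsP' ebs => v j v' j' evv' ejj'.
  rewrite /code /= (alpha_eq _ _ _ _ ejj') ?leq_addl //; congr (_ * _).
  by apply/z1eq/(weq_leq _ evv'); rewrite leq_addr.
by apply/z1eq/(weq_leq _ ev)/le_k/leq_addr.
Qed.

(** Induction on the size of [R], then on that of [D]. If a letter [a] does not permute [R], then
    [rmuls R a] is a smaller saturated family and [D :\ a] a smaller alphabet, as [cover_block]
    requires. *)
Lemma henckell_cover R D : saturated R -> D \subset R -> exists k zeta, covered R D k zeta.
Proof.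
have [n] := ubnP #|R|; elim: n R D => // n IHn R D ltRn satR.
have [d] := ubnP #|D|; elim: d D => // d IHd D ltDd DR.
have [permR|] := pselect (forall a, a \in D -> rmuls R a = R).
  exact: cover_permuting.
move/existsNP => [a /not_implyP[aD /eqP Ra]].
have aR := subsetP DR a aD.
apply: (@cover_block R D a) => //.
  apply: IHd; last exact: subset_trans (subsetDl _ _) DR.
  by move: ltDd; rewrite (cardsD1 a) aD.
apply: IHn => //; last exact: rmuls_saturated.
rewrite -ltnS; apply: leq_trans ltRn; rewrite ltnS; apply/proper_card.
by rewrite properEneq Ra rmuls_sub.
Qed.

End PowerUnion.

(** * Pointlike sets, and the maximal triples *)

Section Henckell.
Variable M : finMonoidType.
Implicit Types (A B C Z : powset M) (F : {set powset M}).

Definition pointlike_family F := saturated F /\ forall x : M, [set x] \in F.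

(** The cover is applied to words of singletons, whose product is the singleton of the value.
    Equivalence is preserved by the letter map from [x] to [[set x]]. *)
Lemma pointlike_family_cover F : pointlike_family F ->
  exists k, forall w : seq M, exists2 Y, Y \in F & wpreim k w \subset Y.
Proof.
case=> satF singF.
have [k [zeta [zeta1 zetaF zeta_sub zeta_eq]]] := henckell_cover satF (subxx F).
pose single w := [seq [set x] : powset M | x <- w].
have singleF w : all (mem F) (single w) by rewrite all_map; apply/allP=> x _ /=.
have singleE w : \prod_(A <- single w) A = [set weval w].
  elim: w => [|x w IH]; first by rewrite big_nil /weval big_nil.
  rewrite big_cons {}IH /weval big_cons; apply/setP=> y; rewrite inE.
  apply/imset2P/eqP => [[_ _ /set1P-> /set1P-> ->] // | ->].
  by exists x (weval w); rewrite ?inE.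
exists k => w; exists (zeta (single w)).
  by case: w => [|x w]; [rewrite zeta1 singF | apply: zetaF].
apply/subsetP=> _ /wpreimP[x ex <-].
rewrite -(zeta_eq _ _ (weq_map (fun y => [set y] : powset M) ex)).
by apply: (subsetP (zeta_sub _ (singleF x))); rewrite singleE set11.
Qed.

Lemma pointlike_sub V (A B : powset M) : A \subset B -> pointlike V B -> pointlike V A.
Proof.
move=> sAB plB N phi VN rphi; have [n sB] := plB N phi VN rphi.
by exists n; apply: subset_trans sB.
Qed.

Definition pointlikes : {set powset M} := [set Z | `[< pointlike aperiodic Z >]].

(** For [power_union]: the powers of [a] with exponent at least [n] coincide, and by periodicity
    each exponent in the union can be raised above [n]. *)
Lemma pointlikes_family : pointlike_family pointlikes.
Proof.
split; first split.
- move=> A B; rewrite !inE => /asboolP plA /asboolP plB; apply/asboolP=> N phi apN rphi.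
  have [a sA] := plA N phi apN rphi; have [b sB] := plB N phi apN rphi.
  by exists (a * b); apply: rel_preimM.
- move=> A; rewrite !inE => /asboolP plA; apply/asboolP=> N phi apN rphi.
  have [a sA] := plA N phi apN rphi; have [n absorb] := aperiodic_exp apN.
  exists (a ^+ n); apply/subsetP=> m /power_unionP[j].
  rewrite -(@exp_fact _ A _ n); last exact: leq_trans (pow_bound_card M) (leq_addr _ _).
  have le_n : n <= (pow_bound M + j + n * pow_bound M)%N.
    by rewrite (leq_trans _ (leq_addl _ _)) // leq_pmulr // fact_gt0.
  by rewrite -(absorb _ _ le_n); apply: (subsetP (rel_preimX rphi _ sA)).
move=> x; rewrite inE; apply/asboolP=> N phi _ [phi0 _ _].
by have /set0Pn[n xn] := phi0 x; exists n; rewrite sub1set inE.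
Qed.

(** Henckell's theorem in a form open to exhaustive search. One direction is the cover; for the
    other, the pointlike sets are themselves such a family. *)
Lemma pointlikeP Z : pointlike aperiodic Z <->
  forall F, pointlike_family F -> exists2 Y, Y \in F & Z \subset Y.
Proof.
split=> [plZ F /pointlike_family_cover[k coverF] | /(_ _ pointlikes_family)[Y]]; last first.
  by rewrite inE => /asboolP plY sZY; apply: pointlike_sub plY.
have [n] := plZ _ _ (wclass_aperiodic M k) (word_relation M k).
rewrite -(wreprK n) rel_preim_word => sZ; have [Y YF sY] := coverF (wrepr n).
by exists Y => //; apply: subset_trans sY.
Qed.

Lemma wpreim_pointlike : exists k, forall w : seq M, pointlike aperiodic (wpreim k w).
Proof.
have [k coverF] := pointlike_family_cover pointlikes_family; exists k => w.
have [Y] := coverF w; rewrite inE => /asboolP plY sY; exact: pointlike_sub plY.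
Qed.

Lemma A_tripleP A B C : V_triple aperiodic A B C <->
  exists A' B' C' : powset M, [/\ A \subset A', B \subset B', C \subset C'
                                & stabilizing_triple A' B' C'].
Proof.
have [k plk] := wpreim_pointlike; split; first exact: A_triple_stabilizing plk.
by case=> A' [B' [C' [sA sB sC /stabilizing_triple_A]]]; apply: V_triple_sub.
Qed.

(** Stabilizing triples are A-triples, and every A-triple lies below a stabilizing one, so the
    maximal elements are the same. *)
Lemma maximal_A_triple A B C :
  maximal_triple (@V_triple aperiodic M) A B C <->
  maximal_triple (@stabilizing_triple M) A B C.
Proof.
split=> -[tr maxtr].
  have /A_tripleP[A' [B' [C' [sA sB sC st]]]] := tr.
  have [eA eB eC] := maxtr _ _ _ (stabilizing_triple_A st) sA sB sC.
  rewrite -eA -eB -eC; split=> // A2 B2 C2 /stabilizing_triple_A tr2.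
  by rewrite eA eB eC; apply: maxtr.
split=> [|A1 B1 C1 /A_tripleP[A' [B' [C' [sA sB sC st]]]] sA1 sB1 sC1].
  exact: stabilizing_triple_A.
have [eA eB eC] := maxtr _ _ _ st
  (subset_trans sA1 sA) (subset_trans sB1 sB) (subset_trans sC1 sC).
by split; apply/eqP; rewrite eqEsubset ?sA1 ?sB1 ?sC1 -?eA -?eB -?eC ?sA ?sB ?sC.
Qed.

End Henckell.

(** * Recursive functions *)

Local Open Scope nat_scope.

(* The list is the environment of variables, read as infinite by [nth 0]. The lemmas
   on binders expect the bound variable at the head of an environment extended by
   two entries, the counter and the accumulator of the underlying [iteri]. *)
Definition rec_fun (f : seq nat -> nat) :=
  forall k, recursive (fun v : k.-tuple nat => f v).

Definition rec_pred (p : seq nat -> bool) := rec_fun (fun s => p s).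

Lemma eq_prf f g : f =1 g -> rec_fun f -> rec_fun g.
Proof. by move=> e fP k; apply: rec_ext (fP k) => v; apply: e. Qed.

Lemma rec_fun_nth i : rec_fun (fun s => nth 0 s i).
Proof.
move=> k; have [lti|lei] := ltnP i k.
  by apply: rec_ext (rec_proj (Ordinal lti)) => v; rewrite (tnth_nth 0).
by apply: rec_ext (rec_zero k) => v; rewrite nth_default // size_tuple.
Qed.

Lemma nth_iter_behead j s i : nth 0 (iter j behead s) i = nth 0 s (j + i).
Proof.
elim: j s => // j IH s; rewrite iterSr IH nth_behead.
by rewrite addSn.
Qed.

(** Each binder adds two [behead] to the environment of the outer variables. *)
Lemma rec_fun_var j i : rec_fun (fun s => nth 0 (iter j behead s) i).
Proof. by apply: eq_prf (rec_fun_nth (j + i)) => s; rewrite nth_iter_behead. Qed.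

Lemma rec_fun_comp f (gs : seq (seq nat -> nat)) :
  rec_fun f -> (forall i, i < size gs -> rec_fun (nth (fun=> 0) gs i)) ->
  rec_fun (fun s => f [seq g s | g <- gs]).
Proof.
move=> fP gsP k.
have gP (i : 'I_(size gs)) : recursive (fun v : k.-tuple nat => nth (fun=> 0) gs i v).
  exact: gsP.
apply: rec_ext (rec_comp (fP _) gP) => v; congr f; apply: (@eq_from_nth _ 0).
  by rewrite size_tuple size_map.
move=> i; rewrite size_tuple => lti; rewrite (nth_map (fun=> 0)) //.
by rewrite -[i]/(nat_of_ord (Ordinal lti)) -tnth_nth tnth_mktuple.
Qed.

Lemma rec_fun_succ f : rec_fun f -> rec_fun (fun s => (f s).+1).
Proof.
move=> fP k; apply: rec_ext (rec_comp rec_succ (g := fun=> _) (fun=> fP k)) => v.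
by rewrite /thead tnth_mktuple.
Qed.

Lemma rec_fun_const c : rec_fun (fun=> c).
Proof. by elim: c => [|c IH]; [move=> k; apply: rec_zero | apply: rec_fun_succ]. Qed.

Lemma rec_fun_iteri n f (g : nat -> nat -> seq nat -> nat) :
  rec_fun n -> rec_fun f ->
  rec_fun (fun s => g (nth 0 s 0) (nth 0 s 1) (behead (behead s))) ->
  rec_fun (fun s => iteri (n s) (fun i r => g i r s) (f s)).
Proof.
move=> nP fP gP k; have recP := rec_prim (fP k) (gP k.+2).
(* Primitive recursion runs on the head of the tuple, so it is composed with the map that puts [n v]
   in front of [v]. *)
pose G (i : 'I_k.+1) (s : seq nat) := if unlift ord0 i is Some j then nth 0 s j else n s.
have GP i : recursive (fun v : k.-tuple nat => G i v).
  by rewrite /G; case: (unlift ord0 i) => [j|]; [apply: rec_fun_nth | apply: nP].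
apply: rec_ext (rec_comp recP GP) => v.
have -> : [tuple G i v | i < k.+1] = [tuple of n v :: v].
  apply: eq_from_tnth => i; rewrite tnth_mktuple /G; case: unliftP => [j|] ->.
    by rewrite tnthS (tnth_nth 0).
  by [].
rewrite theadE; have -> : [tuple of behead [tuple of n v :: v]] = v by apply: val_inj.
by elim: (n v) => //= m ->.
Qed.

Ltac rec_fun_leaf := first [ assumption | exact: rec_fun_const | exact: (rec_fun_var 0)
  | exact: (rec_fun_var 2) | exact: (rec_fun_var 4) | exact: (rec_fun_var 6) ].

(** With this and its analogues in more arguments, an operation need only be shown recursive on
    variables. *)
Lemma rec_fun_comp1 F a : rec_fun (fun s => F (nth 0 s 0)) ->
  rec_fun a -> rec_fun (fun s => F (a s)).
Proof.
by move=> FP aP; apply: (rec_fun_comp (gs := [:: a]) FP) => -[|i].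
Qed.

Lemma rec_fun_comp2 F a b : rec_fun (fun s => F (nth 0 s 0) (nth 0 s 1)) ->
  rec_fun a -> rec_fun b -> rec_fun (fun s => F (a s) (b s)).
Proof.
by move=> FP aP bP; apply: (rec_fun_comp (gs := [:: a; b]) FP) => -[|[|i]].
Qed.

Lemma rec_fun_add a b : rec_fun a -> rec_fun b -> rec_fun (fun s => a s + b s).
Proof.
apply: rec_fun_comp2.
have: rec_fun (fun s => iteri (nth 0 s 0) (fun _ r => r.+1) (nth 0 s 1)).
  by apply: rec_fun_iteri; [| | apply: rec_fun_succ]; rec_fun_leaf.
by apply: eq_prf => s; elim: (nth 0 s 0) => //= n ->.
Qed.

Lemma rec_fun_mul a b : rec_fun a -> rec_fun b -> rec_fun (fun s => a s * b s).
Proof.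
apply: rec_fun_comp2.
have: rec_fun (fun s => iteri (nth 0 s 0) (fun _ r => nth 0 s 1 + r) 0).
  by apply: rec_fun_iteri; [| | apply: rec_fun_add]; rec_fun_leaf.
by apply: eq_prf => s; elim: (nth 0 s 0) => //= n ->.
Qed.

Lemma rec_fun_exp a b : rec_fun a -> rec_fun b -> rec_fun (fun s => a s ^ b s).
Proof.
apply: rec_fun_comp2.
have: rec_fun (fun s => iteri (nth 0 s 1) (fun _ r => nth 0 s 0 * r) 1).
  by apply: rec_fun_iteri; [| | apply: rec_fun_mul]; rec_fun_leaf.
by apply: eq_prf => s; elim: (nth 0 s 1) => //= n ->; rewrite expnS.
Qed.

Lemma rec_fun_fact a : rec_fun a -> rec_fun (fun s => (a s)`!).
Proof.
apply: (@rec_fun_comp1 factorial).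
have: rec_fun (fun s => iteri (nth 0 s 0) (fun i r => i.+1 * r) 1).
  by apply: rec_fun_iteri; [| | apply: rec_fun_mul => //; first apply: rec_fun_succ];
    rec_fun_leaf.
by apply: eq_prf => s; elim: (nth 0 s 0) => //= n ->.
Qed.

Lemma rec_fun_pred a : rec_fun a -> rec_fun (fun s => (a s).-1).
Proof.
apply: rec_fun_comp1.
have: rec_fun (fun s => iteri (nth 0 s 0) (fun i r => i) 0).
  by apply: rec_fun_iteri; rec_fun_leaf.
by apply: eq_prf => s; case: (nth 0 s 0).
Qed.

Lemma rec_fun_sub a b : rec_fun a -> rec_fun b -> rec_fun (fun s => a s - b s).
Proof.
apply: rec_fun_comp2.
have: rec_fun (fun s => iteri (nth 0 s 1) (fun _ r => r.-1) (nth 0 s 0)).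
  by apply: rec_fun_iteri; [| | apply: rec_fun_pred]; rec_fun_leaf.
by apply: eq_prf => s; elim: (nth 0 s 1) => [|n] /=; rewrite ?subn0 // => ->; rewrite subnS.
Qed.

Lemma rec_pred_not p : rec_pred p -> rec_pred (fun s => ~~ p s).
Proof.
move=> pP; have: rec_fun (fun s => 1 - p s) by apply: rec_fun_sub => //; apply: rec_fun_const.
by apply: eq_prf => s; case: (p s).
Qed.

Lemma rec_pred_and p q : rec_pred p -> rec_pred q -> rec_pred (fun s => p s && q s).
Proof.
move=> pP qP; have: rec_fun (fun s => p s * q s) by apply: rec_fun_mul.
by apply: eq_prf => s; rewrite mulnb.
Qed.

Lemma rec_pred_or p q : rec_pred p -> rec_pred q -> rec_pred (fun s => p s || q s).
Proof.
move=> pP qP; have: rec_pred (fun s => ~~ (~~ p s && ~~ q s)).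
  by apply/rec_pred_not/rec_pred_and; apply: rec_pred_not.
by apply: eq_prf => s; rewrite negb_and !negbK.
Qed.

Lemma rec_pred_imply p q : rec_pred p -> rec_pred q -> rec_pred (fun s => p s ==> q s).
Proof.
move=> pP qP; have: rec_pred (fun s => ~~ p s || q s).
  by apply: rec_pred_or => //; apply: rec_pred_not.
by apply: eq_prf => s; rewrite implybE.
Qed.

Lemma rec_pred_leq a b : rec_fun a -> rec_fun b -> rec_pred (fun s => a s <= b s).
Proof.
move=> aP bP; have: rec_fun (fun s => 1 - (a s - b s)).
  by do !apply: rec_fun_sub => //; apply: rec_fun_const.
by apply: eq_prf => s; rewrite /leq; case: (a s - b s).
Qed.

Lemma rec_pred_eq a b : rec_fun a -> rec_fun b -> rec_pred (fun s => a s == b s).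
Proof.
move=> aP bP; have: rec_pred (fun s => (a s <= b s) && (b s <= a s)).
  by apply: rec_pred_and; apply: rec_pred_leq.
by apply: eq_prf => s; rewrite -eqn_leq.
Qed.

Lemma rec_fun_sum n (F : nat -> seq nat -> nat) :
  rec_fun n -> rec_fun (fun s => F (nth 0 s 0) (behead (behead s))) ->
  rec_fun (fun s => \sum_(i <- iota 0 (n s)) F i s).
Proof.
move=> nP FP; have: rec_fun (fun s => iteri (n s) (fun i r => r + F i s) 0).
  by apply: rec_fun_iteri; [| | apply: rec_fun_add]; rec_fun_leaf.
apply: eq_prf => s; elim: (n s) => [|m IH]; first by rewrite big_nil.
by rewrite -[in RHS]addn1 iotaD big_cat big_seq1 -IH.
Qed.

Lemma rec_fun_count n (P : nat -> seq nat -> bool) :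
  rec_fun n -> rec_pred (fun s => P (nth 0 s 0) (behead (behead s))) ->
  rec_fun (fun s => \sum_(i <- iota 0 (n s)) P i s).
Proof. exact: (@rec_fun_sum n (fun i s => P i s)). Qed.

Lemma rec_pred_has n (P : nat -> seq nat -> bool) :
  rec_fun n -> rec_pred (fun s => P (nth 0 s 0) (behead (behead s))) ->
  rec_pred (fun s => has (fun i => P i s) (iota 0 (n s))).
Proof.
move=> nP PP; have: rec_pred (fun s => 0 < \sum_(i <- iota 0 (n s)) P i s).
  by apply: rec_pred_leq; [apply: rec_fun_const | apply: rec_fun_count].
apply: eq_prf => s; congr nat_of_bool.
by rewrite has_count -sum1_count [in RHS]big_mkcond.
Qed.

Lemma rec_pred_all n (P : nat -> seq nat -> bool) :
  rec_fun n -> rec_pred (fun s => P (nth 0 s 0) (behead (behead s))) ->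
  rec_pred (fun s => all (fun i => P i s) (iota 0 (n s))).
Proof.
move=> nP PP; have: rec_pred (fun s => ~~ has (fun i => ~~ P i s) (iota 0 (n s))).
  by apply/rec_pred_not/rec_pred_has => //; apply: rec_pred_not.
apply: eq_prf => s; rewrite -all_predC; congr nat_of_bool.
by apply: eq_all => i /=; rewrite negbK.
Qed.

Lemma rec_fun_div a b : rec_fun a -> rec_fun b -> rec_fun (fun s => a s %/ b s).
Proof.
move=> aP bP; apply: (@rec_fun_comp2 divn) aP bP.
(* The quotient counts the positive multiples of the divisor up to the dividend; the condition on
   the divisor gives 0 for division by 0, as [divn] does. *)
have: rec_fun (fun s => \sum_(i <- iota 0 (nth 0 s 0))
    ((0 < nth 0 s 1) && (i.+1 * nth 0 s 1 <= nth 0 s 0))).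
  apply: rec_fun_count; first by rec_fun_leaf.
  apply: rec_pred_and; apply: rec_pred_leq; try by rec_fun_leaf.
  by apply: rec_fun_mul; [apply: rec_fun_succ|]; rec_fun_leaf.
apply: eq_prf => s; case: (posnP (nth 0 s 1)) => [-> | b_gt0].
  by rewrite divn0 big1.
rewrite (eq_bigr (fun i => (i < nth 0 s 0 %/ nth 0 s 1) : nat)); last first.
  by move=> i _; rewrite leq_divRL.
rewrite -big_mkcond /= sum1_count -size_filter.
by rewrite (@filter_iota_ltn 0) ?size_iota ?leq_div.
Qed.

Lemma rec_fun_mod a b : rec_fun a -> rec_fun b -> rec_fun (fun s => a s %% b s).
Proof.
move=> aP bP; have: rec_fun (fun s => a s - a s %/ b s * b s).
  by apply: rec_fun_sub => //; apply: rec_fun_mul => //; apply: rec_fun_div.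
by apply: eq_prf => s; rewrite {1}(divn_eq (a s) (b s)) addKn.
Qed.

Lemma rec_pred_odd a : rec_fun a -> rec_pred (fun s => odd (a s)).
Proof.
move=> aP; have: rec_fun (fun s => a s %% 2) by apply: rec_fun_mod => //; apply: rec_fun_const.
by apply: eq_prf => s; rewrite modn2.
Qed.

(** * Codes of subsets *)

Section Digits.
Variables (J : finType) (f d : J -> nat) (b : nat).
Hypotheses (f_inj : injective f) (d_le : forall j, d j <= b).

Lemma low_digits m : \sum_(j | f j < m) d j * b.+1 ^ f j < b.+1 ^ m.
Proof.
elim: m => [|m IH]; first by rewrite big_pred0.
rewrite (bigID (fun j => f j == m)) /= expnS mulSn addnC -addSn; apply: leq_add.
  rewrite (eq_bigl (fun j => f j < m)) // => j.
  by rewrite andbC ltnS ltn_neqAle.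
have [j /eqP Dj|no_j] := pickP (fun j => f j == m).
  rewrite (big_pred1 j) => [|i /=]; first by rewrite Dj leq_mul.
  rewrite -(inj_eq f_inj) Dj andbC; case: eqP => //= ->; exact: ltnSn.
by rewrite big_pred0 // => j; rewrite no_j andbF.
Qed.

(** The terms at lower positions sum to less than [b.+1 ^ f j0] by [low_digits], and those at higher
    positions are multiples of the next power. *)
Lemma digitE j0 : (\sum_j d j * b.+1 ^ f j) %/ b.+1 ^ f j0 %% b.+1 = d j0.
Proof.
rewrite (bigID (fun j => f j < f j0)) /= (bigID (fun j => f j == f j0) (fun j => ~~ _)) /=.
rewrite [in X in _ + (X + _)](big_pred1 j0) => [|j /=]; last first.
  by rewrite (inj_eq f_inj); case: eqP => [->|]; rewrite ?andbF // ltnn.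
have /dvdnP[q ->] : b.+1 ^ (f j0).+1 %|
    \sum_(j | ~~ (f j < f j0) && (f j != f j0)) d j * b.+1 ^ f j.
  apply: dvdn_sum => j /andP[le_j ne_j]; apply/dvdn_mull/dvdn_exp2l.
  by rewrite ltn_neqAle eq_sym ne_j leqNgt.
rewrite expnS mulnA -mulnDl [X in X %/ _]addnC divnMDl ?expn_gt0 //.
by rewrite divn_small ?low_digits // addn0 addnC modnMDl modn_small ?ltnS.
Qed.

End Digits.

Section SubsetCodes.
Variables (T : finType) (n : nat) (e : T -> 'I_n).
Hypothesis e_bij : bijective e.
Implicit Types (A B : {set T}).

Let e_inj : injective (fun x => e x : nat).
Proof. by move=> x y /val_inj/(bij_inj e_bij). Qed.

(** The sum of [subset_code] over an arbitrary finite type: with the numbering [set_ord] of the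
    subsets, it also encodes families of subsets. *)
Definition set_code A := \sum_(x in A) 2 ^ e x.

Definition bit (c x : nat) := odd (c %/ 2 ^ x).

Lemma set_codeE A : set_code A = \sum_x (x \in A) * 2 ^ e x.
Proof.
by rewrite /set_code big_mkcond; apply: eq_bigr => x _; case: (x \in A); rewrite ?mul1n.
Qed.

Lemma bit_code A x : bit (set_code A) (e x) = (x \in A).
Proof.
rewrite /bit -[odd _]lt0b -modn2 set_codeE (@digitE _ _ (fun x => x \in A : nat) 1) ?lt0b //.
by move=> y; case: (y \in A).
Qed.

Lemma set_code_inj : injective set_code.
Proof. by move=> A B eAB; apply/setP=> x; rewrite -!bit_code eAB. Qed.

Lemma set_code_lt A : set_code A < 2 ^ n.
Proof.
rewrite set_codeE; have := @low_digits _ _ (fun x => x \in A : nat) 1 e_inj _ n.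
rewrite (eq_bigl xpredT) => [->//|x]; last by rewrite ltn_ord.
by move=> y; case: (y \in A).
Qed.

Definition set_ord A : 'I_(2 ^ n) := Ordinal (set_code_lt A).

Lemma set_ord_bij : bijective set_ord.
Proof.
apply: inj_card_bij => [A B /(congr1 val)/set_code_inj //|].
by rewrite card_ord -cardsT -powersetT card_powerset cardsT (bij_eq_card e_bij) card_ord.
Qed.

Lemma sum_bits (p : nat -> bool) :
  \sum_(z <- iota 0 n) p z * 2 ^ z = set_code [set x | p (e x)].
Proof.
rewrite set_codeE -[X in iota 0 X]subn0 big_mkord (reindex e) /=; last exact: onW_bij.
by apply: eq_bigr => x _; rewrite inE.
Qed.

Lemma has_code (p : nat -> bool) : has p (iota 0 n) = [exists x, p (e x)].
Proof.
apply/hasP/existsP => [[z] | [x px]]; last first.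
  by exists (nat_of_ord (e x)); rewrite ?mem_iota /=.
rewrite mem_iota => /= ltz; have [g _ ge] := e_bij.
by exists (g (Ordinal ltz)); rewrite ge.
Qed.

Lemma all_code (p : nat -> bool) : all p (iota 0 n) = [forall x, p (e x)].
Proof.
rewrite -[all _ _]negbK -has_predC has_code negb_exists.
by apply: eq_forallb => x; rewrite /= negbK.
Qed.

End SubsetCodes.

(** * The decision procedure *)

Lemma rec_fun_bool p : rec_pred p -> rec_fun (fun s => p s : nat). Proof. by []. Qed.

(** The rule is chosen by the syntax of the body. The cases for variables stop at three nested
    binders, the deepest nesting in the codes below. *)
Ltac rec_fun_step := match goal with
  | |- rec_fun (fun s => nth 0 s _) => exact: (rec_fun_var 0)
  | |- rec_fun (fun s => nth 0 (behead (behead s)) _) => exact: (rec_fun_var 2)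
  | |- rec_fun (fun s => nth 0 (behead (behead (behead (behead s)))) _) =>
         exact: (rec_fun_var 4)
  | |- rec_fun (fun s => nth 0 (behead (behead (behead (behead (behead (behead s)))))) _) =>
         exact: (rec_fun_var 6)
  | |- rec_fun (fun s => ?c) => exact: rec_fun_const
  | |- rec_fun (fun s => nat_of_bool (@?p s)) => apply: rec_fun_bool
  | |- rec_fun (fun s => (@?a s) + (@?b s)) => apply: rec_fun_add
  | |- rec_fun (fun s => (@?a s) * (@?b s)) => apply: rec_fun_mul
  | |- rec_fun (fun s => (@?a s) ^ (@?b s)) => apply: rec_fun_exp
  | |- rec_fun (fun s => (@?a s) %/ (@?b s)) => apply: rec_fun_div
  | |- rec_fun (fun s => (@?a s) %% (@?b s)) => apply: rec_fun_mod
  | |- rec_fun (fun s => (@?a s)`!) => apply: rec_fun_fact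
  | |- rec_fun (fun s => (@?a s).-1) => apply: rec_fun_pred
  | |- rec_fun (fun s => \sum_(i <- iota 0 (@?a s)) (@?F s i)) => apply: rec_fun_sum
  | |- rec_fun (fun s => iteri (@?a s) (@?g s) (@?f s)) => apply: rec_fun_iteri
  | |- rec_pred (fun s => (@?a s) == (@?b s)) => apply: rec_pred_eq
  | |- rec_pred (fun s => odd (@?a s)) => apply: rec_pred_odd
  | |- rec_pred (fun s => (@?p s) && (@?q s)) => apply: rec_pred_and
  | |- rec_pred (fun s => (@?p s) || (@?q s)) => apply: rec_pred_or
  | |- rec_pred (fun s => (@?p s) ==> (@?q s)) => apply: rec_pred_imply
  | |- rec_pred (fun s => has (@?P s) (iota 0 (@?a s))) => apply: rec_pred_has
  | |- rec_pred (fun s => all (@?P s) (iota 0 (@?a s))) => apply: rec_pred_all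
  end.

Lemma rec_fun_comp3 F a b c : rec_fun (fun s => F (nth 0 s 0) (nth 0 s 1) (nth 0 s 2)) ->
  rec_fun a -> rec_fun b -> rec_fun c -> rec_fun (fun s => F (a s) (b s) (c s)).
Proof.
by move=> FP aP bP cP; apply: (rec_fun_comp (gs := [:: a; b; c]) FP) => -[|[|[|i]]].
Qed.

Lemma rec_fun_comp4 F a b c d :
  rec_fun (fun s => F (nth 0 s 0) (nth 0 s 1) (nth 0 s 2) (nth 0 s 3)) ->
  rec_fun a -> rec_fun b -> rec_fun c -> rec_fun d ->
  rec_fun (fun s => F (a s) (b s) (c s) (d s)).
Proof.
by move=> FP aP bP cP dP; apply: (rec_fun_comp (gs := [:: a; b; c; d]) FP) => -[|[|[|[|i]]]].
Qed.

Lemma rec_fun_comp5 F a b c d e :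
  rec_fun (fun s => F (nth 0 s 0) (nth 0 s 1) (nth 0 s 2) (nth 0 s 3) (nth 0 s 4)) ->
  rec_fun a -> rec_fun b -> rec_fun c -> rec_fun d -> rec_fun e ->
  rec_fun (fun s => F (a s) (b s) (c s) (d s) (e s)).
Proof.
move=> FP aP bP cP dP eP.
by apply: (rec_fun_comp (gs := [:: a; b; c; d; e]) FP) => -[|[|[|[|[|i]]]]].
Qed.

Definition mul_code n t x y := (t %/ n ^ (n * x + y)) %% n.

Definition prod_code n t A B := \sum_(z <- iota 0 n)
  has (fun x => has (fun y => [&& bit A x, bit B y & mul_code n t x y == z])
    (iota 0 n)) (iota 0 n) * 2 ^ z.

(* The code of A^(k+1). *)
Definition exp_code n t A k := iteri k (fun _ r => prod_code n t r A) A.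

(** The factorial of [2 ^ n] is [pow_bound], and the predecessor offsets the shift of exponents in
    [exp_code]. *)
Definition power_union_code n t A := \sum_(z <- iota 0 n)
  has (fun j => bit (exp_code n t A ((2 ^ n)`! + j).-1) z) (iota 0 (2 ^ n)`!) * 2 ^ z.

Definition subset_codes n A B := all (fun x => bit A x ==> bit B x) (iota 0 n).

(** [2 ^ x] is the code of the singleton of the element with number [x]. *)
Definition family_code n t F :=
  [&& all (fun x => bit F (2 ^ x)) (iota 0 n),
      all (fun A => all (fun B => bit F A && bit F B ==> bit F (prod_code n t A B))
        (iota 0 (2 ^ n))) (iota 0 (2 ^ n))
    & all (fun A => bit F A ==> bit F (power_union_code n t A)) (iota 0 (2 ^ n))].

(** The criterion [pointlikeP], with [F] running over the codes of all families of subsets. *)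
Definition pointlike_code n t A :=
  all (fun F => family_code n t F ==>
      has (fun B => bit F B && subset_codes n A B) (iota 0 (2 ^ n)))
    (iota 0 (2 ^ (2 ^ n))).

Definition equation1_code n t B C := prod_code n t B C == B.

Definition equation2_code n t A B C :=
  has (fun T => [&& pointlike_code n t T, prod_code n t (prod_code n t A B) T == A
                  & C == prod_code n t T B]) (iota 0 (2 ^ n)).

(* The exponent of the third case is [i.+1]; by periodicity of the powers it suffices
   to try the exponents 1, ..., 2^n. *)
Definition equation3_code n t A B C :=
  has (fun S => has (fun T => has (fun i =>
     [&& pointlike_code n t S, pointlike_code n t T,
         A == prod_code n t (prod_code n t A T) S,
         B == prod_code n t (exp_code n t (prod_code n t T S) i) T
       & C == prod_code n t S T]) (iota 0 (2 ^ n))) (iota 0 (2 ^ n))) (iota 0 (2 ^ n)).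

Definition stabilizing_code n t A B C :=
  [&& pointlike_code n t A, pointlike_code n t B, pointlike_code n t C
    & [|| equation1_code n t B C, equation2_code n t A B C | equation3_code n t A B C]].

Definition triple_code n t A B C :=
  has (fun A' => has (fun B' => has (fun C' =>
    [&& subset_codes n A A', subset_codes n B B', subset_codes n C C'
      & stabilizing_code n t A' B' C']) (iota 0 (2 ^ n))) (iota 0 (2 ^ n))) (iota 0 (2 ^ n)).

Lemma rec_pred_bit a b : rec_fun a -> rec_fun b -> rec_pred (fun s => bit (a s) (b s)).
Proof. by move=> aP bP; rewrite /bit; do !rec_fun_step. Qed.

Lemma rec_fun_mul_code n t x y : rec_fun n -> rec_fun t -> rec_fun x -> rec_fun y ->
  rec_fun (fun s => mul_code (n s) (t s) (x s) (y s)).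
Proof. by apply: rec_fun_comp4; rewrite /mul_code; do !rec_fun_step. Qed.

Lemma rec_fun_prod_code n t A B : rec_fun n -> rec_fun t -> rec_fun A -> rec_fun B ->
  rec_fun (fun s => prod_code (n s) (t s) (A s) (B s)).
Proof.
apply: rec_fun_comp4; rewrite /prod_code.
by do !first [rec_fun_step | apply: rec_pred_bit | apply: rec_fun_mul_code].
Qed.

Lemma rec_fun_exp_code n t A k : rec_fun n -> rec_fun t -> rec_fun A -> rec_fun k ->
  rec_fun (fun s => exp_code (n s) (t s) (A s) (k s)).
Proof.
by apply: rec_fun_comp4; rewrite /exp_code; do !first [rec_fun_step | apply: rec_fun_prod_code].
Qed.

Lemma rec_fun_power_union_code n t A : rec_fun n -> rec_fun t -> rec_fun A ->
  rec_fun (fun s => power_union_code (n s) (t s) (A s)).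
Proof.
apply: rec_fun_comp3; rewrite /power_union_code.
by do !first [rec_fun_step | apply: rec_pred_bit | apply: rec_fun_exp_code].
Qed.

Lemma rec_pred_subset_codes n A B : rec_fun n -> rec_fun A -> rec_fun B ->
  rec_pred (fun s => subset_codes (n s) (A s) (B s)).
Proof.
apply: (rec_fun_comp3 (F := fun n A B => subset_codes n A B)); apply: rec_fun_bool.
by rewrite /subset_codes; do !first [rec_fun_step | apply: rec_pred_bit].
Qed.

Lemma rec_pred_family_code n t F : rec_fun n -> rec_fun t -> rec_fun F ->
  rec_pred (fun s => family_code (n s) (t s) (F s)).
Proof.
apply: (rec_fun_comp3 (F := fun n t F => family_code n t F)); apply: rec_fun_bool.
rewrite /family_code.
by do !first [rec_fun_step | apply: rec_pred_bit | apply: rec_fun_prod_code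
  | apply: rec_fun_power_union_code].
Qed.

Lemma rec_pred_pointlike_code n t A : rec_fun n -> rec_fun t -> rec_fun A ->
  rec_pred (fun s => pointlike_code (n s) (t s) (A s)).
Proof.
apply: (rec_fun_comp3 (F := fun n t A => pointlike_code n t A)); apply: rec_fun_bool.
rewrite /pointlike_code.
by do !first [rec_fun_step | apply: rec_pred_bit
  | apply: rec_pred_family_code | apply: rec_pred_subset_codes].
Qed.

Lemma rec_pred_stabilizing_code n t A B C :
  rec_fun n -> rec_fun t -> rec_fun A -> rec_fun B -> rec_fun C ->
  rec_pred (fun s => stabilizing_code (n s) (t s) (A s) (B s) (C s)).
Proof.
apply: (rec_fun_comp5 (F := fun n t A B C => stabilizing_code n t A B C)); apply: rec_fun_bool.
rewrite /stabilizing_code /equation1_code /equation2_code /equation3_code.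
by do !first [rec_fun_step | apply: rec_fun_prod_code
  | apply: rec_fun_exp_code | apply: rec_pred_pointlike_code].
Qed.

Lemma rec_pred_triple_code n t A B C :
  rec_fun n -> rec_fun t -> rec_fun A -> rec_fun B -> rec_fun C ->
  rec_pred (fun s => triple_code (n s) (t s) (A s) (B s) (C s)).
Proof.
apply: (rec_fun_comp5 (F := fun n t A B C => triple_code n t A B C)); apply: rec_fun_bool.
rewrite /triple_code.
by do !first [rec_fun_step | apply: rec_pred_subset_codes | apply: rec_pred_stabilizing_code].
Qed.

(** * Correctness of the decision procedure *)

Local Open Scope group_scope.

Section Correctness.
Variables (M : finMonoidType) (n : nat) (e : M -> 'I_n).
Hypothesis e_bij : bijective e.
Implicit Types (A B C Z S T : powset M) (F : {set powset M}).

Let t := table_code e.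
Let code (A : powset M) := set_code e A.
Let powset_ord : powset M -> 'I_(2 ^ n) := set_ord e_bij.
Let powset_ord_bij : bijective powset_ord := set_ord_bij e_bij.

(** This is [digitE] in base [n]; the positions [n * e x + e y] are distinct by Euclidean
    division. *)
Lemma mul_codeE (x y : M) : mul_code n t (e x) (e y) = e (x * y).
Proof.
have n_gt0 : 0 < n by apply: leq_ltn_trans (ltn_ord (e 1)).
rewrite /mul_code /t /table_code pair_big /=.
have f_inj : injective (fun p : M * M => (n * e p.1 + e p.2)%N).
  move=> [x1 y1] [x2 y2] /= exy.
  have : (e x1 = e x2 :> nat) /\ (e y1 = e y2 :> nat).
    split.
      by move/(congr1 (divn^~ n)): exy; rewrite !(mulnC n) !divnMDl // !divn_small // !addn0.
    by move/(congr1 (modn^~ n)): exy; rewrite !(mulnC n) !modnMDl !modn_small.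
  by case=> /val_inj/(bij_inj e_bij)-> /val_inj/(bij_inj e_bij)->.
have d_le (p : M * M) : e (p.1 * p.2) <= n.-1 by rewrite -ltnS prednK.
by have := digitE f_inj d_le (x, y); rewrite /= prednK.
Qed.

Lemma prod_codeE A B : prod_code n t (code A) (code B) = code (A * B).
Proof.
rewrite /prod_code (sum_bits e_bij (fun z => has _ _)); congr (set_code e _).
apply/setP=> z; rewrite inE (has_code e_bij); apply/existsP/imset2P.
  case=> x; rewrite (has_code e_bij) => /existsP[y].
  rewrite !bit_code // mul_codeE => /and3P[xA yB /eqP/val_inj/(bij_inj e_bij) <-].
  by exists x y.
case=> x y xA yB ->; exists x; rewrite (has_code e_bij); apply/existsP; exists y.
by rewrite !bit_code // mul_codeE xA yB eqxx.
Qed.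

Lemma exp_codeE A k : exp_code n t (code A) k = code (A ^+ k.+1).
Proof. by elim: k => //= k ->; rewrite prod_codeE -expgSr. Qed.

Lemma card_powset : #|{: powset M}| = (2 ^ n)%N.
Proof. by rewrite (bij_eq_card powset_ord_bij) card_ord. Qed.

Lemma power_union_codeE A : power_union_code n t (code A) = code (power_union A).
Proof.
rewrite /power_union_code (sum_bits e_bij (fun z => has _ _)); congr (set_code e _).
apply/setP=> z; rewrite !inE.
have -> : ((2 ^ n)`!)%N = pow_bound M by rewrite /pow_bound card_powset.
apply/hasP/existsP => [[j]|[j zA]].
  rewrite mem_iota /= => ltj; rewrite exp_codeE bit_code // prednK => [zA|].
    by exists (Ordinal ltj).
  by rewrite addn_gt0 fact_gt0.
exists (j : nat); first by rewrite mem_iota /=.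
by rewrite exp_codeE bit_code // prednK // addn_gt0 fact_gt0.
Qed.

Lemma subset_codesE A B : subset_codes n (code A) (code B) = (A \subset B).
Proof.
rewrite /subset_codes (all_code e_bij); apply/forallP/subsetP => sAB x.
  by move/implyP: (sAB x); rewrite !bit_code.
by rewrite !bit_code //; apply/implyP/sAB.
Qed.

Lemma has_set (p : nat -> bool) :
  has p (iota 0 (2 ^ n)) = [exists A : powset M, p (code A)].
Proof. exact: has_code powset_ord_bij p. Qed.

Lemma all_set (p : nat -> bool) :
  all p (iota 0 (2 ^ n)) = [forall A : powset M, p (code A)].
Proof. exact: all_code powset_ord_bij p. Qed.

Lemma code_eq A B : (code A == code B) = (A == B).
Proof. exact: inj_eq (set_code_inj e_bij) _ _. Qed.

Let family F := set_code powset_ord F.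

Lemma bit_family F A : bit (family F) (code A) = (A \in F).
Proof. exact: (bit_code powset_ord_bij). Qed.

Lemma family_codeE F : family_code n t (family F) <-> pointlike_family F.
Proof.
have bit1 x : bit (family F) (2 ^ e x) = ([set x] \in F).
  by rewrite -bit_family /code /set_code big_set1.
rewrite /family_code (all_code e_bij) !all_set; split.
  case/and3P=> /forallP F1 /forallP FM /forallP FU; split; last by move=> x; rewrite -bit1.
  split=> [A B AF BF | A AF].
    have := FM A; rewrite all_set => /forallP/(_ B).
    by rewrite prod_codeE !bit_family AF BF.
  by have := FU A; rewrite power_union_codeE !bit_family AF.
case=> -[FM FU] F1; apply/and3P; split; apply/forallP.
- by move=> x; rewrite bit1.
- move=> A; rewrite all_set; apply/forallP=> B.
  by rewrite prod_codeE !bit_family; apply/implyP=> /andP[]; apply: FM.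
by move=> A; rewrite power_union_codeE !bit_family; apply/implyP/FU.
Qed.

Lemma pointlike_codeE A : pointlike_code n t (code A) <-> pointlike aperiodic A.
Proof.
(* Here [set_ord] is applied twice: the numbering of the subsets yields a numbering of the
   families. *)
rewrite /pointlike_code (all_code (set_ord_bij powset_ord_bij)).
apply: iff_trans (iff_sym (pointlikeP A)); split.
  move=> /forallP plA F /family_codeE famF.
  have /implyP/(_ famF) := plA F; rewrite has_set => /existsP[Y].
  by rewrite bit_family subset_codesE => /andP[]; exists Y.
move=> plA; apply/forallP=> F; apply/implyP => /family_codeE/plA[Y YF sAY].
by rewrite has_set; apply/existsP; exists Y; rewrite bit_family subset_codesE YF.
Qed.

(** Beyond the preperiod [k] the exponent is reduced modulo the period [p], and [k + p] is at most
    the number of subsets. *)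
Lemma exp_bounded (x : powset M) i : exists2 j, j < 2 ^ n & x ^+ i.+1 = x ^+ j.+1.
Proof.
have [k [p [p_gt0 le_kp xP]]] := exp_period x; rewrite card_powset in le_kp.
have [ltk|lek] := ltnP i k.
  by exists i => //; apply: leq_trans ltk _; apply: leq_trans le_kp; apply: leq_addr.
exists (k + (i - k) %% p)%N.
  by apply: leq_trans le_kp; rewrite ltn_add2l ltn_mod.
rewrite -{1}(subnKC lek) {1}(divn_eq (i - k) p) [(_ * p + _)%N]addnC addnA -addSn xP //.
by rewrite -addnS leq_addr.
Qed.

Lemma equation2_codeE A B C : equation2_code n t (code A) (code B) (code C) <->
  exists T : powset M, [/\ pointlike aperiodic T, A * B * T = A & C = T * B].
Proof.
rewrite /equation2_code has_set; split=> [/existsP|] [T].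
  by rewrite !prod_codeE !code_eq => /and3P[/pointlike_codeE plT /eqP ABT /eqP CTB]; exists T.
case=> /pointlike_codeE plT ABT CTB; apply/existsP; exists T.
by rewrite !prod_codeE !code_eq plT ABT -CTB !eqxx.
Qed.

Lemma equation3_codeE A B C : equation3_code n t (code A) (code B) (code C) <->
  exists (S T : powset M) (i : nat),
    [/\ pointlike aperiodic S, pointlike aperiodic T & 0 < i] /\
    [/\ A = A * T * S, B = (T * S) ^+ i * T & C = S * T].
Proof.
rewrite /equation3_code has_set; split=> [/existsP|] [S].
  rewrite has_set => /existsP[T] /hasP[i _].
  rewrite !prod_codeE exp_codeE !prod_codeE !code_eq.
  case/and5P=> /pointlike_codeE plS /pointlike_codeE plT /eqP eA /eqP eB /eqP eC.
  by exists S, T, i.+1.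
case=> T [[|i] [[/pointlike_codeE plS /pointlike_codeE plT //]] _ [eA eB eC]].
apply/existsP; exists S; rewrite has_set; apply/existsP; exists T; apply/hasP.
have [j ltj ej] := exp_bounded (T * S) i; exists j; first by rewrite mem_iota.
by rewrite !prod_codeE exp_codeE !prod_codeE !code_eq plS plT -ej -eA -eB -eC !eqxx.
Qed.

Lemma stabilizing_codeE A B C : stabilizing_code n t (code A) (code B) (code C) <->
  stabilizing_triple A B C.
Proof.
rewrite /stabilizing_code /equation1_code prod_codeE code_eq; split.
  case/and4P=> /pointlike_codeE plA /pointlike_codeE plB /pointlike_codeE plC eqs.
  split=> //; case/or3P: eqs => [/eqP|/equation2_codeE|/equation3_codeE].
  - by apply: Or31.
  - by apply: Or32.
  - by apply: Or33.
case=> /pointlike_codeE-> /pointlike_codeE-> /pointlike_codeE-> eqs /=.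
apply/or3P; case: eqs => [/eqP|/equation2_codeE|/equation3_codeE].
- by apply: Or31.
- by apply: Or32.
- by apply: Or33.
Qed.

Lemma triple_codeE A B C :
  triple_code n t (code A) (code B) (code C) <-> V_triple aperiodic A B C.
Proof.
apply: iff_trans (iff_sym (A_tripleP A B C)); rewrite /triple_code has_set.
split=> [/existsP|] [A'].
  rewrite has_set => /existsP[B']; rewrite has_set => /existsP[C'].
  by rewrite !subset_codesE => /and4P[sA sB sC /stabilizing_codeE]; exists A', B', C'.
case=> B' [C' [sA sB sC /stabilizing_codeE st]].
apply/existsP; exists A'; rewrite has_set; apply/existsP; exists B'.
rewrite has_set; apply/existsP; exists C'.
by rewrite !subset_codesE sA sB sC.
Qed.

End Correctness.

Lemma A_triple_decidable : algorithmically_decidable (@V_triple aperiodic).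
Proof.
have tripleP : rec_pred (fun s => triple_code (nth 0 s 0) (nth 0 s 1) (nth 0 s 2)
    (nth 0 s 3) (nth 0 s 4))%N by apply: rec_pred_triple_code; apply: rec_fun_nth.
exists (fun v : 5.-tuple nat => triple_code (nth 0 v 0) (nth 0 v 1) (nth 0 v 2)
    (nth 0 v 3) (nth 0 v 4) : nat)%N; first exact: tripleP.
move=> M n e e_bij A B C /=; apply: iff_trans (triple_codeE e_bij A B C).
by split=> [/eqP|->] //; rewrite eqb1.
Qed.

Theorem corollary7p3 :
  (forall (M : finMonoidType) (A B C : powset M),
    maximal_triple (@V_triple aperiodic M) A B C <->
    maximal_triple
      (fun A B C : powset M =>
        [/\ pointlike aperiodic A, pointlike aperiodic B,
            pointlike aperiodic C &
            [\/ B * C = B,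
                exists T : powset M,
                  [/\ pointlike aperiodic T, A * B * T = A & C = T * B]
              | exists (S T : powset M) (i : nat),
                  [/\ pointlike aperiodic S, pointlike aperiodic T & (1 <= i)%N] /\
                  [/\ A = A * T * S, B = (T * S) ^+ i * T & C = S * T]]])
      A B C) /\
  algorithmically_decidable (@V_triple aperiodic).
Proof. split; [exact: maximal_A_triple | exact: A_triple_decidable]. Qed.
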